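(* Assume that (H2) holds. Then for any $y_0\in\mathcal{D}$ and $w_0\in\mathbb{R}^n$, there exists $\delta>0$ small enough such that a unique mild solution $(y(t),w(t))$ of the Maxey--Riley system $$\dot y=w+A_u(y,t),\qquad \dot w=-\mu w-M_u(y,t)w-\kappa\mu^{1/2}\frac{d}{dt}\int_{t_0}^{t}\frac{w(s)}{\sqrt{t-s}}\,ds+B_u(y,t),\qquad y(t_0)=y_0,\ w(t_0)=w_0,$$ exists over the time interval $[t_0,t_0+\delta]$, and it is continuously differentiable with respect to its initial condition $(y_0,w_0)$.
   Context: Let $n\in\{2,3\}$, let $\mathcal{D}\subseteq\mathbb{R}^n$ be open, $\mathbb{R}^+=[0,\infty)$, $t_0\in\mathbb{R}^+$, and let $u:\mathcal{D}\times\mathbb{R}^+\to\mathbb{R}^n$, $u=u(x,t)$, be a fluid velocity field. Let $R=\frac{2\rho_f}{\rho_f+2\rho_p}$, $\mu=R/\mathrm{St}$, $\kappa=\sqrt{9R/(2\pi)}$, $\gamma=\frac{9R}{2\mathrm{Re}}$ be positive constants (with densities $\rho_f,\rho_p>0$ and Stokes and Reynolds numbers $\mathrm{St},\mathrm{Re}>0$), and let $g\in\mathbb{R}^n$ be a constant vector. Write $(\nabla f)_{ij}=\partial f_i/\partial x_j$ for the spatial Jacobian of a vector field $f$, $\Delta$ for the componentwise spatial Laplacian, and $\frac{D}{Dt}=\partial_t+u\cdot\nabla$ for the material derivative. Define on $\mathcal{D}\times\mathbb{R}^+$: $$A_u=u+\frac{\gamma}{6}\mu^{-1}\Delta u,\qquad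 M_u=\nabla u+\frac{\gamma}{6}\mu^{-1}\nabla\Delta u,$$ $$B_u=\Big(\frac{3R}{2}-1\Big)\Big(\frac{Du}{Dt}-g\Big)+\Big(\frac{R}{20}-\frac16\Big)\gamma\mu^{-1}\frac{D}{Dt}\Delta u-\frac{\gamma}{6}\mu^{-1}\Big[\nabla u+\frac{\gamma}{6}\mu^{-1}\nabla\Delta u\Big]\Delta u .$$ Assumption (H2): $u(x,t)$ is four times continuously differentiable in its arguments over $\mathcal{D}\times\mathbb{R}^+$. Its partial derivatives (including mixed partials) are uniformly bounded and Lipschitz continuous up to order three (order zero, i.e. $u$ itself, included). A mild solution on $[t_0,t_0+\delta]$ is a continuous function $(y,w):[t_0,t_0+\delta]\to\mathcal{D}\times\mathbb{R}^n$ satisfying $$y(t)=y_0+\int_{t_0}^{t}\big[w(s)+A_u(y(s),s)\big]\,ds,$$ $$w(t)=w_0+\int_{t_0}^{t}\Big[-\mu\,w(s)-M_u(y(s),s)w(s)-\kappa\mu^{1/2}\frac{w(s)}{\sqrt{t-s}}+B_u(y(s),s)\Big]\,ds .$$ Continuous differentiability with respect to the initial condition means: mild solutions over $[t_0,t_0+\delta]$ exist uniquely for all initial conditions in some neighbourhood of $(y_0,w_0)$ in $\mathcal{D}\times\mathbb{R}^n$, and for each $t\in[t_0,t_0+\delta]$ the map sending the initial condition to $(y(t),w(t))$ is continuously differentiable on that neighbourhood. *)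

(* Defs.v *)
From mathcomp Require Import all_boot all_order all_algebra.
From mathcomp Require Import all_classical all_reals all_analysis.

Set Implicit Arguments.
Unset Strict Implicit.
Unset Printing Implicit Defensive.

Import Order.TTheory GRing.Theory Num.Theory.
Import numFieldNormedType.Exports.

Local Open Scope classical_set_scope.
Local Open Scope ring_scope.

(* Space-time functions are total on 'cV[R]_n * R; only their values on
   [spacetime D] are relevant. *)
Section Fields.
Context {R : realType} {n : nat}.
Local Notation E := 'cV[R]_n.
Implicit Types (D : set E) (f : E * R -> R) (v u : E * R -> E) (p : E * R).

Definition spacetime D : set (E * R) := D `*` [set t | 0 <= t].

(* The time variable ranges over [0, +oo[, so the difference quotient is
   restricted to increments h with 0 <= t + h: the derivative is the usual one
   for t > 0 and the right derivative for t = 0. *)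
Definition time_quotient f p : R -> R :=
  fun h => h^-1 * (f (p.1, p.2 + h) - f p).

Definition time_increments (t : R) : set_system R :=
  within [set h | 0 <= t + h] 0^'.

(* [None] is the time direction, [Some j] the j-th space direction. *)
Definition partial (a : option 'I_n) f p : R :=
  match a with
  | None => lim (time_quotient f p @ time_increments p.2)
  | Some j => 'D_(delta_mx j 0) (fun x : E => f (x, p.2)) p.1
  end.

Definition has_partial (a : option 'I_n) f p : Prop :=
  match a with
  | None => cvg (time_quotient f p @ time_increments p.2)
  | Some j => derivable (fun x : E => f (x, p.2)) p.1 (delta_mx j 0)
  end.

(* Iterated (mixed) partial derivative; the last letter acts first. *)
Definition partials (s : seq (option 'I_n)) f : E * R -> R :=
  foldr partial f s.

Definition coord (i : 'I_n) v : E * R -> R := fun p => v p i 0.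

(* Continuity is relative to the subspace [spacetime D], hence one-sided in
   time at t = 0. *)
Definition scalar_Ck (k : nat) D f : Prop :=
  (forall s a p, (size s < k)%N -> spacetime D p ->
     has_partial a (partials s f) p) /\
  (forall s, (size s <= k)%N -> {within spacetime D, continuous (partials s f)}).

Definition H2 D u : Prop :=
  (forall i, scalar_Ck 4 D (coord i u)) /\
  (forall i s, (size s <= 3)%N ->
     [bounded partials s (coord i u) p | p in spacetime D] /\
     [lipschitz partials s (coord i u) p | p in spacetime D]).

Definition jac v p : 'M[R]_n := \matrix_(i, j) partial (Some j) (coord i v) p.

Definition laplacian v p : E :=
  \col_i \sum_(j < n) partials [:: Some j; Some j] (coord i v) p.

Definition time_derivative v p : E := \col_i partial None (coord i v) p.

(* D v / D t = d_t v + (u . grad) v, where (u . grad) v = (grad v) u. *)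
Definition material u v p : E := time_derivative v p + jac v p *m u p.

Definition A_field (gamma mu : R) u p : E :=
  u p + (gamma / 6 * mu^-1) *: laplacian u p.

Definition M_field (gamma mu : R) u p : 'M[R]_n :=
  jac u p + (gamma / 6 * mu^-1) *: jac (laplacian u) p.

Definition B_field (Rr gamma mu : R) (g : E) u p : E :=
  (3 * Rr / 2 - 1) *: (material u u p - g)
  + ((Rr / 20 - 1 / 6) * gamma * mu^-1) *: material u (laplacian u) p
  - (gamma / 6 * mu^-1) *: (M_field gamma mu u p *m laplacian u p).

End Fields.

Section MildSolutions.
Context {R : realType} {n : nat}.
Local Notation E := 'cV[R]_n.

Definition vintegrable (a b : R) (f : R -> E) : Prop :=
  forall i, (@lebesgue_measure R).-integrable `[a, b] (fun s => (f s i 0)%:E).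

Definition vintegral (a b : R) (f : R -> E) : E :=
  \col_i \int[@lebesgue_measure R]_(s in `[a, b]) f s i 0.

Variables (D : set E) (A : E * R -> E) (M : E * R -> 'M[R]_n) (B : E * R -> E).
Variables (mu kappa t0 delta : R).

Definition y_integrand (z : R -> E * E) (s : R) : E :=
  (z s).2 + A ((z s).1, s).

(* At s = t the singular term is 0 since 0^-1 = 0; this is a null set. *)
Definition w_integrand (z : R -> E * E) (t s : R) : E :=
  - (mu *: (z s).2) - M ((z s).1, s) *m (z s).2
  - (kappa * Num.sqrt mu) *: ((Num.sqrt (t - s))^-1 *: (z s).2)
  + B ((z s).1, s).

(* z = (y, w) on [t0, t0 + delta], with initial condition z0 = (y0, w0). *)
Definition mild_solution (z0 : E * E) (z : R -> E * E) : Prop :=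
  [/\ {within `[t0, t0 + delta], continuous z},
      forall t, t \in `[t0, t0 + delta] -> D (z t).1,
      forall t, t \in `[t0, t0 + delta] ->
        vintegrable t0 t (y_integrand z) /\
        (z t).1 = z0.1 + vintegral t0 t (y_integrand z) &
      forall t, t \in `[t0, t0 + delta] ->
        vintegrable t0 t (w_integrand z t) /\
        (z t).2 = z0.2 + vintegral t0 t (w_integrand z t)].

Definition unique_mild_solution (z0 : E * E) (z : R -> E * E) : Prop :=
  mild_solution z0 z /\
  (forall z', mild_solution z0 z' ->
     forall t, t \in `[t0, t0 + delta] -> z' t = z t).

(* The derivative is continuous for the operator norm. *)
Definition C1_on (V W : normedModType R) (U : set V) (F : V -> W) : Prop :=
  (forall x, U x -> differentiable F x) /\
  (forall x, U x -> forall e : R, 0 < e ->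
     \forall x' \near x, forall h : V, `|'d F x' h - 'd F x h| <= e * `|h|).

Definition C1_initial_condition (z0 : E * E) : Prop :=
  exists (U : set (E * E)) (Phi : E * E -> R -> E * E),
    [/\ open_nbhs z0 U,
        U `<=` D `*` setT,
        forall z, U z -> unique_mild_solution z (Phi z) &
        forall t, t \in `[t0, t0 + delta] -> C1_on U (Phi ^~ t)].

End MildSolutions.

(* Main.v *)
Require Import Defs.
From HB Require Import structures.
From mathcomp Require Import all_boot all_order all_algebra.
From mathcomp Require Import all_classical all_reals all_analysis.
From mathcomp Require Import measurable_realfun ring lra.
Import Order.TTheory GRing.Theory Num.Theory.
Import numFieldNormedType.Exports.
Local Open Scope classical_set_scope.
Local Open Scope ring_scope.
Set Implicit Arguments. Unset Strict Implicit. Unset Printing Implicit Defensive.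

(** A mild solution is a fixed point of an integral operator whose kernel has the
    integrable singularity [1 / sqrt (t - s)]. Writing [z = (y, w)] and
    [k t s = 1 / sqrt (t - s)], the system reads
      [z t = z0 + \int_t0^t (k t s *: L (z s) + G s (z s)) ds],
    where [L] is linear and [G] collects all regular terms. The integral of the
    kernel over a segment of length [d] is at most [2 sqrt d], so on a short
    interval the operator contracts the sup norm like that of an ordinary
    differential equation. Existence is Picard iteration ([volterra_exists]).
    Everything else is a comparison of solutions by one estimate,
    [abel_stability]: a difference of solutions is bounded by its data plus half
    of its own supremum.

    The regularity of the velocity field enters in two ways. The partial
    derivatives of order at most three are bounded and Lipschitz on all of
    space-time, hence so are the coefficients [A], [M] and [B]
    ([A_field_C1_lip], [M_field_C1_lip], [B_field_C1_lip]); this yields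
    uniqueness among all mild solutions in the domain. The fourth derivatives are
    continuous, so the coefficients are continuously differentiable in space,
    and on a compact box their first-order expansion holds uniformly
    ([first_order_expansion], by the mean value theorem along coordinate lines).

    For the dependence on the initial condition ([C1_dependence]), the equation
    is first truncated to a box around the given initial condition, which makes
    it solvable from every point; nearby solutions never meet the truncation.
    The candidate derivative in the direction [h] is the solution of the
    linearized equation with initial condition [h]. The remainder of the solution
    map and the difference of two such derivatives both solve linear equations
    whose source terms are small by the uniform expansion, and [abel_stability]
    turns this into differentiability and continuity of the derivative. *)

(** * The singular kernel *)

Section SingularKernel.
Context {R : realType}.
Local Notation leb := (@lebesgue_measure R).
Implicit Types a b c s t : R.

(** Since [Num.sqrt] vanishes on negative numbers and [0^-1 = 0], the kernel is
    [0] for [t <= s]; it is only discontinuous at [s = t]. *)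
Definition abel_kernel t s : R := (Num.sqrt (t - s))^-1.

Lemma abel_kernel_ge0 t s : 0 <= abel_kernel t s.
Proof. by rewrite invr_ge0 sqrtr_ge0. Qed.

Lemma abel_kernel_decr s t t' : s < t -> t <= t' ->
  abel_kernel t' s <= abel_kernel t s.
Proof.
move=> st tt'; rewrite lef_pV2 ?posrE ?sqrtr_gt0 ?subr_gt0 //.
  by rewrite ler_sqrt ?subr_ge0 ?lerD2r //; exact/ltW/(lt_le_trans st).
exact: lt_le_trans tt'.
Qed.

Lemma measurable_abel_kernel a b t : b <= t ->
  measurable_fun `[a, b] (abel_kernel t).
Proof.
(* For [s <= t] the kernel is the power [- 1 / 2] of [t - s], including the
   value [0] at [s = t]. *)
move=> bt; have : measurable_fun `[a, b] (fun s => powR (t - s) (- 2^-1)).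
  apply: (measurableT_comp (measurable_powR _)).
  by apply: measurable_funB => //; exact: measurable_id.
apply: eq_measurable_fun => s; rewrite inE /= in_itv /= => /andP[_ sb].
by rewrite powRN powR12_sqrt // subr_ge0 (le_trans sb).
Qed.

Lemma integral_abel_kernel_lt a b t : a <= b -> b < t ->
  (\int[leb]_(s in `[a, b]) (abel_kernel t s)%:E =
   (2 * Num.sqrt (t - a) - 2 * Num.sqrt (t - b))%:E)%E.
Proof.
rewrite le_eqVlt => /predU1P[-> bt|ab bt].
  by rewrite set_itv1 integral_set1 subrr.
have D s : s < t -> is_derive s 1 (fun s => - (2 * Num.sqrt (t - s)))
    (abel_kernel t s).
  move=> st; have ts : 0 < t - s by rewrite subr_gt0.
  have h1 : is_derive s 1 (fun s : R => t - s) (- 1 : R).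
    by rewrite -(sub0r (1 : R)); apply: is_deriveB.
  have h2 := @is_derive1_comp _ Num.sqrt (fun s : R => t - s) _ _ _ (is_derive1_sqrt ts) h1.
  have h3 := is_deriveN (is_deriveZ 2 h2).
  apply: (is_derive_eq h3).
  rewrite /abel_kernel invfM /GRing.scale /=.
  by field; rewrite lt0r_neq0 // sqrtr_gt0.
have C s : s < t -> {for s, continuous (fun s => - (2 * Num.sqrt (t - s)))}.
  by move=> /D [/derivable1_diffP/differentiable_continuous].
rewrite (@continuous_FTC2 _ _ (fun s => - (2 * Num.sqrt (t - s)))) //.
- by rewrite -EFinB; congr (_%:E); ring.
- apply: continuous_in_subspaceT => s; rewrite inE /= in_itv /= => /andP[_ sb].
  have st : s < t by exact: le_lt_trans bt.
  apply: (@continuousV _ _ (fun s => Num.sqrt (t - s))).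
    by rewrite lt0r_neq0 // sqrtr_gt0 subr_gt0.
  apply: continuous_comp; last exact: sqrt_continuous.
  by apply: continuousB; [exact: cst_continuous|exact: cvg_id].
- split.
  + by move=> s; rewrite in_itv /= => /andP[_ sb]; case: (D s (lt_trans sb bt)).
  + exact/cvg_at_right_filter/(C _ (lt_trans ab bt)).
  + exact/cvg_at_left_filter/(C _ bt).
- move=> s; rewrite in_itv /= => /andP[_ sb].
  by rewrite derive1E; apply/derive_val; exact: (D s (lt_trans sb bt)).
Qed.

(** At the singular endpoint [b = t] the fundamental theorem of calculus does
    not apply; the half-open interval is exhausted by segments ending before
    [t] and monotone convergence gives the value. *)
Lemma integral_abel_kernel a b t : a <= b -> b <= t ->
  (\int[leb]_(s in `[a, b]) (abel_kernel t s)%:E =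
   (2 * Num.sqrt (t - a) - 2 * Num.sqrt (t - b))%:E)%E.
Proof.
move=> ab; rewrite le_eqVlt => /predU1P[bt|]; last exact: integral_abel_kernel_lt.
move: ab; rewrite {}bt le_eqVlt => /predU1P[->|ab].
  by rewrite set_itv1 integral_set1 subrr.
rewrite -integral_itv_bndo_bndc; last first.
  apply: (@measurable_funS _ _ _ _ `[a, t]) => //; first exact: subset_itv_co_cc.
  by apply/measurable_EFinP; exact: measurable_abel_kernel.
pose b_ (n : nat) : R := t - (t - a) * n.+1%:R^-1.
have b_lt n : b_ n < t.
  by rewrite /b_ ltrBlDr ltrDl mulr_gt0 ?subr_gt0 // invr_gt0 ltr0n.
have b_ge n : a <= b_ n.
  rewrite /b_ lerBrDr -lerBrDl ler_piMr ?subr_ge0 ?(ltW ab) //.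
  by rewrite invf_le1 ?ltr0n // ler1n.
have b_nd n m : (n <= m)%N -> b_ n <= b_ m.
  move=> nm; rewrite /b_ lerD2l lerN2 ler_wpM2l ?subr_ge0 ?(ltW ab) //.
  by rewrite lef_pV2 ?posrE ?ltr0n // ler_nat.
have -> : `[a, t[%classic = \bigcup_n `[a, b_ n]%classic.
  apply/seteqP; split=> [s /=|s [n _] /=]; rewrite !in_itv /=; last first.
    by move=> /andP[-> sb]; exact: le_lt_trans sb (b_lt n).
  move=> /andP[as_ st].
  have ts : 0 < t - s by rewrite subr_gt0.
  have ta : 0 < t - a by rewrite subr_gt0.
  exists (Num.bound ((t - a) / (t - s))) => //=.
  rewrite in_itv /= as_ /= /b_ lerBrDr -lerBrDl.
  rewrite ler_pdivrMr ?ltr0n // -ler_pdivrMl // mulrC.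
  apply/ltW/(lt_le_trans (archi_boundP _)); first by rewrite divr_ge0 ?ltW.
  by rewrite ler_nat.
have mk n : measurable_fun `[a, b_ n] (fun s => (abel_kernel t s)%:E).
  by apply/measurable_EFinP; apply: measurable_abel_kernel; apply/ltW.
have cv : (\int[leb]_(s in `[a, b_ n]) (abel_kernel t s)%:E)%E @[n --> \oo] -->
    (\int[leb]_(s in \bigcup_n `[a, b_ n]%classic) (abel_kernel t s)%:E)%E.
  apply: ge0_nondecreasing_set_cvg_integral => //.
    move=> n m nm; apply/subsetPset => s /=; rewrite !in_itv /= => /andP[-> sb].
    exact: le_trans sb (b_nd _ _ nm).
  by move=> n s _; rewrite lee_fin abel_kernel_ge0.
apply: (cvg_unique (@ereal_hausdorff R) cv).
rewrite subrr sqrtr0 mulr0 subr0.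
rewrite (_ : (fun n => _) =
    (fun n => (2 * Num.sqrt (t - a) - 2 * Num.sqrt (t - b_ n))%:E)); last first.
  by apply/funext => n; exact: integral_abel_kernel_lt.
apply: cvg_EFin; first by near=> n.
rewrite /=.
have bt : b_ n @[n --> \oo] --> t.
  rewrite -[X in _ --> X]subr0 -[X in _ --> t - X](mulr0 (t - a)).
  apply: cvgB; first exact: cvg_cst.
  by apply: cvgMr; exact: cvg_harmonic.
rewrite -[X in _ --> X]subr0 -(mulr0 2) -[X in _ - _ * X]sqrtr0.
apply: cvgB; first exact: cvg_cst.
apply: cvgMr; apply: continuous_cvg; first exact: sqrt_continuous.
by rewrite -(subrr t); apply: cvgB => //; exact: cvg_cst.
Unshelve. all: by end_near.
Qed.

Lemma integrable_abel_kernel a b t : b <= t ->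
  leb.-integrable `[a, b] (fun s => (abel_kernel t s)%:E).
Proof.
move=> bt; have [ab|ba] := leP a b; last first.
  by rewrite set_itv_ge ?bnd_simp -?ltNge //; exact: integrable_set0.
apply/integrableP; split; first by apply/measurable_EFinP; apply: measurable_abel_kernel.
under eq_integral do rewrite gee0_abs ?lee_fin ?abel_kernel_ge0 //.
by rewrite integral_abel_kernel // ltry.
Qed.

End SingularKernel.

(** * Integrals of vector-valued curves *)

Section VectorIntegral.
Context {R : realType} {n : nat}.
Local Notation leb := (@lebesgue_measure R).
Local Notation E := 'cV[R]_n.
Implicit Types a b c s t A B : R.

Lemma mx_norm_leP m p (v : 'M[R]_(m, p)) A :
  0 <= A -> (forall i j, `|v i j| <= A) -> `|v| <= A.
Proof.
by move=> A0 vA; rewrite [leLHS]mx_normrE; apply/bigmax_leP; split=> // -[].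
Qed.

Lemma ler_mx_entry m p (v : 'M[R]_(m, p)) i j : `|v i j| <= `|v|.
Proof. by rewrite [leRHS]mx_normrE; apply: (le_bigmax _ _ (i, j)). Qed.

Lemma pair_norm_le (U W : normedModType R) (z : U * W) A :
  (`|z| <= A) = (`|z.1| <= A) && (`|z.2| <= A).
Proof. by rewrite prod_normE ge_max. Qed.

Lemma ler_norm1 (U W : normedModType R) (z : U * W) : `|z.1| <= `|z|.
Proof. by rewrite prod_normE le_max lexx. Qed.

Lemma ler_norm2 (U W : normedModType R) (z : U * W) : `|z.2| <= `|z|.
Proof. by rewrite prod_normE le_max lexx orbT. Qed.

(** The bound is only asked for before [b]: when [b] is the singular point the
    kernel takes the value [0] there, and estimates against it may fail. *)
Lemma Rintegral_norm_le a b (f g : R -> R) :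
  leb.-integrable `[a, b] (EFin \o f) -> leb.-integrable `[a, b] (EFin \o g) ->
  (forall s, a <= s < b -> `|f s| <= g s) ->
  `|\int[leb]_(s in `[a, b]) f s| <= \int[leb]_(s in `[a, b]) g s.
Proof.
move=> fi gi fg.
have co h : leb.-integrable `[a, b] (EFin \o h) ->
    leb.-integrable `[a, b[ (EFin \o h).
  by apply: integrableS => //; exact: subset_itv_co_cc.
rewrite -(Rintegral_itv_bndo_bndc (co _ fi)) -(Rintegral_itv_bndo_bndc (co _ gi)).
apply: (le_trans (le_normr_Rintegral _ (co _ fi))) => //.
by apply: le_Rintegral => //; [exact/integrable_norm/co|exact: co].
Qed.

Lemma integrable_abel_bound a b t A B : b <= t ->
  leb.-integrable `[a, b] (EFin \o (fun s => A * abel_kernel t s + B)).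
Proof.
move=> bt.
have ki : leb.-integrable `[a, b] (fun s => A%:E * (abel_kernel t s)%:E)%E.
  by apply: integrableZl => //; exact: integrable_abel_kernel.
have ci : leb.-integrable `[a, b] (EFin \o cst B).
  apply: measurable_bounded_integrable => //.
  - exact: compact_finite_measure (@segment_compact _ _ _).
  - exact: bounded_cst.
by apply: eq_integrable (integrableD _ ki ci).
Qed.

Lemma Rintegral_abel_bound a b t A B : a <= b -> b <= t ->
  \int[leb]_(s in `[a, b]) (A * abel_kernel t s + B) =
  A * (2 * Num.sqrt (t - a) - 2 * Num.sqrt (t - b)) + B * (b - a).
Proof.
move=> ab bt.
have ki : leb.-integrable `[a, b] (EFin \o abel_kernel t).
  exact: integrable_abel_kernel.
have ci : leb.-integrable `[a, b] (EFin \o cst B).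
  by apply: eq_integrable (integrable_abel_bound a 0 B bt) => // s _ /=;
    rewrite mul0r add0r.
rewrite RintegralD //; last first.
  by apply: eq_integrable (integrable_abel_bound a A 0 bt) => // s _ /=;
    rewrite addr0.
rewrite RintegralZl //; congr (_ * _ + _).
  by rewrite /Rintegral integral_abel_kernel.
rewrite Rintegral_cst //=; congr (_ * _).
by rewrite lebesgue_measure_itv /= lte_fin; case: ltgtP ab => //= -> _; rewrite subrr.
Qed.

Lemma vintegral_norm_le a b (f : R -> E) (g : R -> R) :
  vintegrable a b f -> leb.-integrable `[a, b] (EFin \o g) ->
  (forall s, a <= s < b -> `|f s| <= g s) ->
  `|vintegral a b f| <= \int[leb]_(s in `[a, b]) g s.
Proof.
move=> fi gi fg; apply: mx_norm_leP => [|i j].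
  apply: le_trans (@Rintegral_norm_le a b (cst 0) g _ gi _); first exact: normr_ge0.
    by apply: integrable0.
  by move=> s /fg; rewrite normr0; exact: le_trans.
rewrite mxE; apply: Rintegral_norm_le; [exact: fi|exact: gi|].
by move=> s /fg; exact: le_trans (ler_mx_entry _ _ _).
Qed.

Lemma vintegrableB a b (f g : R -> E) :
  vintegrable a b f -> vintegrable a b g -> vintegrable a b (f \- g).
Proof.
move=> fi gi i; apply: eq_integrable (integrableB _ (fi i) (gi i)) => // s _ /=.
by rewrite !mxE.
Qed.

Lemma vintegralB a b (f g : R -> E) : vintegrable a b f -> vintegrable a b g ->
  vintegral a b (f \- g) = vintegral a b f - vintegral a b g.
Proof.
move=> fi gi; apply/colP => i; rewrite !mxE.
rewrite -(RintegralB _ (fi i) (gi i)) //.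
by apply: eq_Rintegral => s _ /=; rewrite !mxE.
Qed.

Lemma vintegral_split a b c (f : R -> E) : a <= b -> b <= c ->
  vintegrable a c f -> vintegral a c f - vintegral a b f = vintegral b c f.
Proof.
move=> ab bc fi; apply/colP => i; rewrite !mxE.
rewrite Rintegral_itvB ?bnd_simp //; last exact: fi.
apply: Rintegral_itv_obnd_cbnd; apply: integrableS (fi i) => //.
by apply: subset_itvr; rewrite bnd_simp.
Qed.

Lemma vintegrable_abel a b t (f g : R -> E) : b <= t ->
  continuous f -> continuous g ->
  vintegrable a b (fun s => abel_kernel t s *: f s + g s).
Proof.
move=> bt cf cg i.
have ent (h : R -> E) : continuous h -> continuous (fun s => h s i 0).
  by move=> ch s; apply: (@cvg_comp _ _ _ h (fun M : E => M i 0) _ (nbhs (h s)));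
    [exact: ch|exact: coord_continuous].
have mh (h : R -> E) : continuous h -> measurable_fun `[a, b] (fun s => h s i 0).
  move=> ch; apply: measurable_funS (continuous_measurable_fun (ent _ ch)) => //.
have bh (h : R -> E) : continuous h -> [bounded h s i 0 | s in `[a, b]].
  move=> ch; have /compact_bounded [M [Mr hM]] :
      compact ((fun s => h s i 0) @` `[a, b]).
    apply: continuous_compact; last exact: segment_compact.
    exact/continuous_subspaceT/ent.
  by exists M; split=> // x Mx s abs; apply: hM Mx _ _; exists s.
pose fi s := f s i 0.
have kf : leb.-integrable `[a, b]
    ((EFin \o fi) \* (fun s => (abel_kernel t s)%:E))%E.
  by apply: integrableMr; [|exact: mh|exact: bh|exact: integrable_abel_kernel].
have gi : leb.-integrable `[a, b] (EFin \o fun s => g s i 0).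
  apply: measurable_bounded_integrable => //.
  - exact: compact_finite_measure (@segment_compact _ _ _).
  - exact: mh.
  - exact: bh.
apply: eq_integrable (integrableD _ kf gi) => // s _ /=.
by rewrite !mxE mulrC.
Qed.

End VectorIntegral.

Section PairIntegral.
Context {R : realType} {n : nat}.
Local Notation leb := (@lebesgue_measure R).
Local Notation E := 'cV[R]_n.
Local Notation V := (E * E)%type.
Implicit Types a b c s t A B : R.

Definition pair_integrable a b (f : R -> V) : Prop :=
  vintegrable a b (fun s => (f s).1) /\ vintegrable a b (fun s => (f s).2).

Definition pair_integral a b (f : R -> V) : V :=
  (vintegral a b (fun s => (f s).1), vintegral a b (fun s => (f s).2)).

Lemma pair_integral_norm_le a b (f : R -> V) (g : R -> R) :
  pair_integrable a b f -> leb.-integrable `[a, b] (EFin \o g) ->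
  (forall s, a <= s < b -> `|f s| <= g s) ->
  `|pair_integral a b f| <= \int[leb]_(s in `[a, b]) g s.
Proof.
move=> [f1 f2] gi fg; rewrite pair_norm_le.
by apply/andP; split; apply: vintegral_norm_le => // s /fg; apply: le_trans;
  [exact: ler_norm1|exact: ler_norm2].
Qed.

Lemma pair_integral_abel_le a b t (f : R -> V) A B : a <= b -> b <= t ->
  pair_integrable a b f ->
  (forall s, a <= s < b -> `|f s| <= A * abel_kernel t s + B) ->
  `|pair_integral a b f| <=
    A * (2 * Num.sqrt (t - a) - 2 * Num.sqrt (t - b)) + B * (b - a).
Proof.
move=> ab bt fi fle; rewrite -Rintegral_abel_bound //.
exact: pair_integral_norm_le (integrable_abel_bound _ _ _ bt) _.
Qed.

Lemma pair_integrableB a b (f g : R -> V) :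
  pair_integrable a b f -> pair_integrable a b g ->
  pair_integrable a b (fun s => f s - g s).
Proof.
by move=> [f1 f2] [g1 g2]; split;
  [exact: vintegrableB f1 g1|exact: vintegrableB f2 g2].
Qed.

Lemma pair_integralB a b (f g : R -> V) :
  pair_integrable a b f -> pair_integrable a b g ->
  pair_integral a b (fun s => f s - g s) = pair_integral a b f - pair_integral a b g.
Proof.
by move=> [f1 f2] [g1 g2]; congr (_, _);
  [exact: vintegralB f1 g1|exact: vintegralB f2 g2].
Qed.

Lemma pair_integral_split a b c (f : R -> V) : a <= b -> b <= c ->
  pair_integrable a c f ->
  pair_integral a c f - pair_integral a b f = pair_integral b c f.
Proof.
move=> ab bc [f1 f2].
by congr (_, _); exact: vintegral_split.
Qed.

Lemma pair_integrable_abel a b t (f g : R -> V) : b <= t ->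
  continuous f -> continuous g ->
  pair_integrable a b (fun s => abel_kernel t s *: f s + g s).
Proof.
move=> bt cf cg; split.
  apply: (@vintegrable_abel _ _ a b t (fun s => (f s).1) (fun s => (g s).1)) => //.
    by move=> s; apply: cvg_comp (cf s) _; exact: cvg_fst.
  by move=> s; apply: cvg_comp (cg s) _; exact: cvg_fst.
apply: (@vintegrable_abel _ _ a b t (fun s => (f s).2) (fun s => (g s).2)) => //.
  by move=> s; apply: cvg_comp (cf s) _; exact: cvg_snd.
by move=> s; apply: cvg_comp (cg s) _; exact: cvg_snd.
Qed.

Lemma within_continuous_bounded (W : normedModType R) a b (f : R -> W) :
  {within `[a, b], continuous f} ->
  exists2 m, 0 <= m & forall s, s \in `[a, b] -> `|f s| <= m.
Proof.
move=> cf; have /compact_bounded [M [Mr hM]] : compact (f @` `[a, b]).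
  by apply: continuous_compact => //; exact: segment_compact.
exists (Num.max 0 (M + 1)); first by rewrite le_max lexx.
move=> s sab; apply: hM; last by exists s.
by rewrite lt_max ltrDl ltr01 orbT.
Qed.

(** Moving the upper limit from [t] to [t'] adds the integral over the segment
    from [t] to [t'] and replaces [abel_kernel t] by the smaller
    [abel_kernel t'] on the old segment. The primitive of the kernel is explicit,
    and each change costs at most [2 m sqrt (t' - t)] in the singular part. *)
Lemma abel_integral_holder a t t' (f g : R -> V) m : a <= t -> t <= t' ->
  continuous f -> continuous g ->
  (forall s, a <= s <= t' -> `|f s| <= m /\ `|g s| <= m) ->
  `|pair_integral a t' (fun s => abel_kernel t' s *: f s + g s) -
    pair_integral a t (fun s => abel_kernel t s *: f s + g s)| <=
  4 * m * Num.sqrt (t' - t) + m * (t' - t).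
Proof.
move=> at_ tt' cf cg fgm.
set h' := fun s => abel_kernel t' s *: f s + g s.
set h := fun s => abel_kernel t s *: f s + g s.
have h'i : pair_integrable a t' h' by exact: pair_integrable_abel.
have h'it : pair_integrable a t h' by exact: pair_integrable_abel.
have hi : pair_integrable a t h by exact: pair_integrable_abel.
have m0 : 0 <= m.
  have [|+ _] := fgm t; first by rewrite at_.
  exact: le_trans.
rewrite -(subrK (pair_integral a t h') (pair_integral a t' h')) -addrA.
rewrite pair_integral_split // -pair_integralB //.
apply: (le_trans (ler_normD _ _)).
have new : `|pair_integral t t' h'| <= 2 * m * Num.sqrt (t' - t) + m * (t' - t).
  have := @pair_integral_abel_le t t' t' h' m m tt' (lexx _).
  rewrite subrr sqrtr0 mulr0 subr0 => /(_ _ _)/le_trans; apply.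
  - by case: h'i => h1 h2; split=> i;
      [apply: integrableS (h1 i)|apply: integrableS (h2 i)] => //;
      apply: subset_itvr; rewrite bnd_simp.
  - move=> s /andP[ts st']; have [|fm gm] := fgm s.
      by rewrite (le_trans at_ ts) ltW.
    apply: (le_trans (ler_normD _ _)); rewrite lerD // normrZ mulrC.
    by rewrite ger0_norm ?abel_kernel_ge0 // ler_wpM2r ?abel_kernel_ge0.
  - by rewrite mulrA (mulrC m).
have old : `|pair_integral a t (fun s => h' s - h s)| <= 2 * m * Num.sqrt (t' - t).
  have ki u : t <= u -> leb.-integrable `[a, t] (EFin \o (fun s => m * abel_kernel u s + 0)).
    exact: integrable_abel_bound.
  have gi : leb.-integrable `[a, t] (EFin \o (fun s =>
      (m * abel_kernel t s + 0) - (m * abel_kernel t' s + 0))).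
    by apply: eq_integrable (integrableB _ (ki _ (lexx _)) (ki _ tt')).
  apply: le_trans (pair_integral_norm_le (pair_integrableB h'it hi) gi _) _.
    move=> s /andP[as_ st]; rewrite /h' /h opprD addrACA subrr addr0 -scalerBl.
    rewrite normrZ distrC ger0_norm ?subr_ge0 ?abel_kernel_decr // !addr0 -mulrBr mulrC.
    rewrite ler_wpM2r ?subr_ge0 ?abel_kernel_decr //.
    by have [] := fgm s; rewrite // as_ ltW // (lt_le_trans st).
  rewrite RintegralB //; [|exact: ki|exact: ki].
  rewrite !Rintegral_abel_bound // subrr sqrtr0 !mul0r !addr0 mulr0 subr0.
  have : Num.sqrt (t - a) <= Num.sqrt (t' - a).
    by rewrite ler_sqrt ?lerD2r // subr_ge0 (le_trans at_).
  by move: (Num.sqrt (t - a)) (Num.sqrt (t' - a)) (Num.sqrt (t' - t)) => x y w xy; nra.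
by apply: (le_trans (lerD new old)); rewrite le_eqVlt; apply/orP; left; apply/eqP; ring.
Qed.

End PairIntegral.

(** * Volterra equations with a weakly singular kernel *)

Section Clamp.
Context {R : realType}.
Implicit Types a b : R.

Definition clamp a b (x : R) : R := Num.max a (Num.min x b).

Lemma clamp_itv a b (x : R) : a <= b -> a <= clamp a b x <= b.
Proof. by move=> ab; rewrite le_max lexx /= ge_max ab ge_min lexx orbT. Qed.

Lemma clamp_id a b (x : R) : a <= x <= b -> clamp a b x = x.
Proof. by move=> /andP[ax xb]; rewrite /clamp min_l // max_r. Qed.

Lemma clamp_lipschitz a b (x y : R) : `|clamp a b x - clamp a b y| <= `|x - y|.
Proof.
have [h|h] := leP 0 (x - y); rewrite ?(ger0_norm h) ?(ltr0_norm h);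
rewrite /clamp ler_norml; case: (leP x b) => ?; case: (leP y b) => ?;
case: (leP a x) => ?; case: (leP a y) => ?; case: (leP a b) => ?; lra.
Qed.

Lemma dist_cvg0 (V : normedModType R) (x : V) (L : R) :
  (L * `|x - y|) @[y --> x] --> (0 : R).
Proof.
rewrite -(mulr0 L) -(normr0 V) -(subrr x); apply: cvgMr; apply: cvg_norm.
by apply: cvgB; [exact: cvg_cst|exact: cvg_id].
Qed.

Lemma lipschitz_continuous (V W : normedModType R) (f : V -> W) (L : R) :
  (forall x y, `|f x - f y| <= L * `|x - y|) -> continuous f.
Proof.
move=> fL x; apply/cvgrPdist_le => eps eps0.
have /cvgrPdist_le /(_ _ eps0) := dist_cvg0 x L; apply: filterS => y.
by rewrite sub0r normrN => /(le_trans (ler_norm _)); exact: le_trans.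
Qed.

End Clamp.

Section Volterra.
Context {R : realType} {n : nat}.
Local Notation E := 'cV[R]_n.
Local Notation V := (E * E)%type.
Variables (t0 d : R).
Hypothesis d0 : 0 <= d.
Local Notation I := (`[t0, t0 + d] : interval R).

(** The left-hand side of the inequality is the factor by which the integral
    operator over a time [d] shrinks the sup norm, for a singular part of size
    [l] and a regular part of size [C]. *)
Definition abel_small (l C : R) : Prop :=
  [/\ 0 <= l, 0 <= C & l * (2 * Num.sqrt d) + C * d <= 2^-1].

Lemma abel_weight_le t l C m e : abel_small l C -> 0 <= m -> 0 <= e -> t \in I ->
  (l * m) * (2 * Num.sqrt (t - t0) - 2 * Num.sqrt (t - t)) +
    (C * m + e) * (t - t0) <= m / 2 + e * d.
Proof.
move=> [l0 C0 sm] m0 e0; rewrite in_itv /= => /andP[t0t td].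
have ttd : t - t0 <= d by rewrite lerBlDl.
have tt0 : 0 <= t - t0 by rewrite subr_ge0.
have xy : Num.sqrt (t - t0) <= Num.sqrt d by rewrite ler_sqrt.
rewrite subrr sqrtr0 mulr0 subr0.
have h1 : 0 <= l * m * (Num.sqrt d - Num.sqrt (t - t0)).
  by rewrite !mulr_ge0 ?subr_ge0.
have h2 : 0 <= (C * m + e) * (d - (t - t0)).
  by rewrite mulr_ge0 ?subr_ge0 // addr_ge0 // mulr_ge0.
have : 0 <= m * (2^-1 - (l * (2 * Num.sqrt d) + C * d)) by rewrite mulr_ge0 ?subr_ge0.
by move: h1 h2; lra.
Qed.

(** On short intervals this replaces Gronwall's inequality: the integral operator
    at least halves sup norms, so a bounded quantity absorbs its own
    contribution to the bound. *)
Lemma sup_absorb (r : R -> R) (a : R) :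
  (exists M, forall t, t \in I -> r t <= M) ->
  (forall m, (forall t, t \in I -> r t <= m) -> forall t, t \in I -> r t <= a + m / 2) ->
  forall t, t \in I -> r t <= 2 * a.
Proof.
move=> [M hM] hr t tI; set S := r @` [set` I].
have ubS : has_ubound S by exists M => _ [s sI <-]; exact: hM.
have leS s : s \in I -> r s <= sup S.
  by move=> sI; apply: ub_le_sup => //; exists s.
have : sup S <= a + sup S / 2.
  by apply: ge_sup; [exists (r t), t|move=> _ [s sI <-]; exact: hr].
by have := leS _ tI; lra.
Qed.

(** The one estimate behind uniqueness, Lipschitz dependence, linearity of the
    derivative, differentiability and continuity of the derivative: [r] is a
    difference of solutions, [f t s] the corresponding combination of their
    integrands, and [e] the part of it that is not controlled by [r]. *)
Lemma abel_stability (r r0 : R -> V) (f : R -> R -> V) l C a e :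
  abel_small l C -> 0 <= e ->
  (exists M, forall t, t \in I -> `|r t| <= M) ->
  (forall t, t \in I -> `|r0 t| <= a) ->
  (forall t, t \in I -> pair_integrable t0 t (f t) /\
     r t = r0 t + pair_integral t0 t (f t)) ->
  (forall t s, t \in I -> t0 <= s < t ->
     `|f t s| <= l * `|r s| * abel_kernel t s + (C * `|r s| + e)) ->
  forall t, t \in I -> `|r t| <= 2 * (a + e * d).
Proof.
move=> sm e0 rb r0a rE fle; apply: sup_absorb => // m rm t tI.
have m0 : 0 <= m by apply: le_trans (rm _ tI).
have [fi ->] := rE _ tI.
apply: (le_trans (ler_normD _ _)); rewrite -addrA lerD ?r0a //.
rewrite addrC; apply: le_trans (abel_weight_le sm m0 e0 tI).
have [l0 C0 _] := sm; have /andP[t0t _] : t0 <= t <= t0 + d by rewrite in_itv in tI.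
apply: pair_integral_abel_le => // s /andP[t0s st].
have sI : s \in I by move: tI; rewrite !in_itv /= t0s => /andP[_]; exact/le_trans/ltW.
apply: (le_trans (fle _ _ tI _)); first by rewrite t0s.
by rewrite !lerD // ?ler_wpM2l ?ler_wpM2r ?abel_kernel_ge0 // ?ler_wpM2l // rm.
Qed.

(** The mild formulation in abstract form: [P] is weighted by the singular
    kernel, [F] is the regular part of the right-hand side. *)
Definition abel_integrand (P F : R -> V -> V) (z : R -> V) (t s : R) : V :=
  abel_kernel t s *: P s (z s) + F s (z s).

Definition volterra_solution (P F : R -> V -> V) (z0 : V) (z : R -> V) : Prop :=
  forall t, t \in I -> pair_integrable t0 t (abel_integrand P F z t) /\
    z t = z0 + pair_integral t0 t (abel_integrand P F z t).

Lemma dyadic_cvg0 (c : R) : (c / 2 ^+ k) @[k --> \oo] --> (0 : R).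
Proof.
rewrite -(mulr0 c); apply: cvgMr.
under eq_fun do rewrite -exprVn.
by apply: cvg_expr; rewrite ger0_norm // invf_lt1 // ltr1n.
Qed.

Lemma dyadic_half (c : R) k : c / 2 ^+ k.+1 + c / 2 ^+ k / 2 = c / 2 ^+ k.
Proof. by rewrite exprSr invfM; move: (2 ^+ k)^-1 => x; field. Qed.

Lemma geometric_cvg (u : nat -> E) c :
  (forall k, `|u k.+1 - u k| <= c / 2 ^+ k) ->
  forall k, `|lim (u @ \oo) - u k| <= 2 * c / 2 ^+ k.
Proof.
move=> uc.
have c0 : 0 <= c by have := le_trans (normr_ge0 _) (uc 0%N); rewrite expr0 divr1.
have far k i : `|u (k + i)%N - u k| <= 2 * c / 2 ^+ k - 2 * c / 2 ^+ (k + i).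
  elim: i => [|i IHi]; first by rewrite addn0 !subrr normr0.
  rewrite -(subrK (u (k + i)%N) (u (k + i.+1)%N)) -addrA.
  apply: (le_trans (ler_normD _ _)); rewrite addnS.
  apply: (le_trans (lerD (uc _) IHi)); rewrite exprS invfM.
  by move: (2 ^+ (k + i))^-1 (2 ^+ k)^-1 => x y; lra.
have ucv : cvg (u @ \oo).
  apply/cauchy_cvgP/cauchy_exP => eps eps0.
  have /cvgrPdist_lt /(_ _ eps0) [N _ hN] := dyadic_cvg0 (2 * c).
  exists (u N), N => // m /= Nm; rewrite -ball_normE /= distrC -(subnKC Nm).
  apply: (le_lt_trans (far _ _)); apply: le_lt_trans (hN N (leqnn N)).
  rewrite sub0r normrN; apply: le_trans (ler_norm _).
  by rewrite lerBlDr lerDl divr_ge0 ?mulr_ge0 // exprn_ge0.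
move=> k; apply/ler_addgt0Pr => eps eps0.
have /cvgrPdist_le /(_ _ eps0) [N _ hN] := ucv.
have := hN (k + N)%N (leq_addl _ _) => /= close.
rewrite -(subrK (u (k + N)%N) (lim (u @ \oo))) -addrA addrC.
apply: (le_trans (ler_normD _ _)); rewrite lerD //.
apply: le_trans (far k N) _.
by rewrite lerBlDr lerDl divr_ge0 ?mulr_ge0 // exprn_ge0.
Qed.

(** Truncating time to the interval turns functions on the interval into
    functions on the whole line, so that continuity and measurability need no
    relativization. *)
Definition clamp_time (t : R) : R := clamp t0 (t0 + d) t.

Lemma clamp_time_in t : clamp_time t \in I.
Proof. by rewrite in_itv /= clamp_itv // lerDl. Qed.

Lemma clamp_time_id t : t \in I -> clamp_time t = t.
Proof. by rewrite in_itv /=; exact: clamp_id. Qed.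

Lemma clamp_time_continuous : continuous clamp_time.
Proof. by apply: (@lipschitz_continuous _ _ _ _ 1) => x y; rewrite mul1r clamp_lipschitz. Qed.

Section Picard.
Variables (P F : R -> V -> V) (l C : R).
Hypothesis Pc : forall z, continuous z -> continuous (fun s => P s (z s)).
Hypothesis Fc : forall z, continuous z -> continuous (fun s => F s (z s)).
Hypothesis Pl : forall s z z', `|P s z - P s z'| <= l * `|z - z'|.
Hypothesis Fl : forall s z z', `|F s z - F s z'| <= C * `|z - z'|.
Hypothesis sm : abel_small l C.
Variable z0 : V.

Let T (z : R -> V) (t : R) : V :=
  z0 + pair_integral t0 (clamp_time t) (abel_integrand P F z (clamp_time t)).

Let integrable_T z t : continuous z -> pair_integrable t0 t (abel_integrand P F z t).
Proof. by move=> cz; apply: pair_integrable_abel => //; [exact: Pc|exact: Fc]. Qed.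

Let T_continuous z : continuous z -> continuous (T z).
Proof.
move=> cz.
have [m1 m10 hm1] := within_continuous_bounded (continuous_subspaceT (Pc cz))
  (a := t0) (b := t0 + d).
have [m2 m20 hm2] := within_continuous_bounded (continuous_subspaceT (Fc cz))
  (a := t0) (b := t0 + d).
pose m := Num.max m1 m2.
have H t t' : t \in I -> t' \in I -> t <= t' ->
    `|pair_integral t0 t' (abel_integrand P F z t') -
      pair_integral t0 t (abel_integrand P F z t)| <=
    4 * m * Num.sqrt `|t' - t| + m * `|t' - t|.
  move=> tI t'I tt'; rewrite (@ger0_norm _ (t' - t)) ?subr_ge0 //.
  move: tI t'I; rewrite !in_itv /= => /andP[t0t _] /andP[_ t'd].
  apply: abel_integral_holder => //; [exact: Pc|exact: Fc|].
  move=> s /andP[t0s st']; have sI : s \in I.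
    by rewrite in_itv /= t0s (le_trans st').
  by rewrite !le_max hm1 // hm2 // orbT.
have H' t t' : `|T z t - T z t'| <= 4 * m * Num.sqrt `|clamp_time t' - clamp_time t| +
    m * `|clamp_time t' - clamp_time t|.
  rewrite /T opprD addrACA subrr add0r.
  have [tt'|/ltW t't] := leP (clamp_time t) (clamp_time t').
    by rewrite distrC; apply: H tt'; exact: clamp_time_in.
  by rewrite (distrC (clamp_time t')); apply: H t't; exact: clamp_time_in.
move=> t; apply/cvgrPdist_le => eps eps0.
have small : (4 * m * Num.sqrt `|clamp_time t' - clamp_time t| +
    m * `|clamp_time t' - clamp_time t|) @[t' --> t] --> (0 : R).
  have c0 : `|clamp_time t' - clamp_time t| @[t' --> t] --> (0 : R).
    rewrite -(normr0 R) -(subrr (clamp_time t)); apply: cvg_norm.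
    by apply: cvgB; [exact: clamp_time_continuous|exact: cvg_cst].
  rewrite -(addr0 0) -[X in _ --> X + _](mulr0 (4 * m)) -[X in _ --> _ + X](mulr0 m).
  apply: cvgD; apply: cvgMr => //.
  rewrite -[X in _ --> X]sqrtr0; apply: continuous_cvg => //; exact: sqrt_continuous.
have /cvgrPdist_le /(_ _ eps0) := small; apply: filterS => t'.
rewrite sub0r normrN => /(le_trans (ler_norm _)); exact: le_trans (H' _ _).
Qed.

Let T_contract z z' m t : continuous z -> continuous z' -> 0 <= m ->
  (forall s, `|z s - z' s| <= m) -> `|T z t - T z' t| <= m / 2.
Proof.
move=> cz cz' m0 zz'; rewrite /T opprD addrACA subrr add0r.
have tI := clamp_time_in t; move: (clamp_time t) tI => {}t tI.
have /andP[t0t _] : t0 <= t <= t0 + d by rewrite in_itv in tI.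
rewrite -pair_integralB; [|exact: integrable_T..].
have := abel_weight_le sm m0 (lexx 0) tI; rewrite mul0r !addr0; apply: le_trans.
apply: pair_integral_abel_le => //.
  by apply: pair_integrableB; exact: integrable_T.
move=> s _; rewrite /abel_integrand opprD addrACA -scalerBr.
have [l0 C0 _] := sm.
apply: (le_trans (ler_normD _ _)); rewrite normrZ ger0_norm ?abel_kernel_ge0 // mulrC.
rewrite lerD ?ler_wpM2r ?abel_kernel_ge0 //.
  by apply: (le_trans (Pl _ _ _)); rewrite ler_wpM2l.
by apply: (le_trans (Fl _ _ _)); rewrite ler_wpM2l.
Qed.

Let it (k : nat) : R -> V := iter k T (cst z0).

Let it_continuous k : continuous (it k).
Proof. by elim: k => [|k IHk] /=; [exact: cst_continuous|exact: T_continuous]. Qed.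

(** Picard iteration: the integral operator halves sup distances, so the iterates
    converge uniformly, the limit is continuous, and it is a fixed point. *)
Lemma volterra_exists : exists2 z, continuous z & volterra_solution P F z0 z.
Proof.
have cdiff : continuous (fun t => it 1%N t - it 0%N t).
  by move=> t; apply: cvgB; exact: it_continuous.
have [c c0 hc] := within_continuous_bounded (continuous_subspaceT cdiff)
  (a := t0) (b := t0 + d).
have step k t : `|it k.+1 t - it k t| <= c / 2 ^+ k.
  elim: k t => [|k IHk] t; last first.
    rewrite exprSr invfM mulrA.
    apply: (T_contract _ (@it_continuous k.+1) (@it_continuous k)) IHk.
    by rewrite divr_ge0 // exprn_ge0.
  rewrite expr0 divr1; have := hc _ (clamp_time_in t).
  by rewrite /= /T (clamp_time_id (clamp_time_in t)).
pose z t : V := (lim ((it k t).1 @[k --> \oo]), lim ((it k t).2 @[k --> \oo])).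
have zk k t : `|z t - it k t| <= 2 * c / 2 ^+ k.
  rewrite pair_norm_le; apply/andP; split.
    apply: (@geometric_cvg (fun k => (it k t).1)) => j.
    exact: le_trans (ler_norm1 _) (step j t).
  apply: (@geometric_cvg (fun k => (it k t).2)) => j.
  exact: le_trans (ler_norm2 _) (step j t).
have small eps : 0 < eps -> exists k, 2 * c / 2 ^+ k <= eps.
  move=> eps0; have /cvgrPdist_le /(_ _ eps0) [N _ hN] := dyadic_cvg0 (2 * c).
  exists N; have := hN N (leqnn N); rewrite /= sub0r normrN.
  exact: le_trans (ler_norm _).
have zc : continuous z.
  move=> t; apply/cvgrPdist_le => eps eps0.
  have eps3 : 0 < eps / 3 by rewrite divr_gt0.
  have [k hk] := small _ eps3.
  have /cvgrPdist_le /(_ _ eps3) := @it_continuous k t.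
  apply: filterS => t' h.
  have h1 := le_trans (zk k t) hk; have h2 := le_trans (zk k t') hk.
  rewrite distrC in h2.
  have -> : z t - z t' = (z t - it k t) + (it k t - it k t') + (it k t' - z t').
    by rewrite !addrA !subrK.
  apply: (le_trans (ler_normD _ _)); apply: (le_trans (lerD (ler_normD _ _) h2)).
  by apply: (le_trans (lerD (lerD h1 h) (lexx _))); lra.
exists z => // t tI; split; first exact: integrable_T.
suff -> : z t = T z t by rewrite /T clamp_time_id.
apply/eqP; rewrite -subr_eq0 -normr_le0; apply/ler_addgt0Pr => eps eps0.
have [k hk] := small _ eps0; rewrite add0r; apply: le_trans hk.
rewrite -(subrK (it k.+1 t) (z t)) -addrA.
apply: (le_trans (ler_normD _ _)).
have h1 := zk k.+1 t.
have h2 : `|it k.+1 t - T z t| <= (2 * c / 2 ^+ k) / 2.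
  apply: (T_contract _ (@it_continuous k) zc).
    by rewrite divr_ge0 ?mulr_ge0 // exprn_ge0.
  by move=> s; rewrite distrC.
by rewrite -(dyadic_half (2 * c) k); exact: le_trans (lerD h1 h2).
Qed.

End Picard.
End Volterra.

(** * Regular scalar fields on space-time *)

Section SpacetimeCalculus.
Context {R : realType} {n : nat}.
Local Notation E := 'cV[R]_n.
Variable D : set E.
Hypothesis hD : open D.
Local Notation S := (spacetime D).
Implicit Types (f g : E * R -> R) (p q : E * R).

(** The regularity that the argument needs of the coefficients: bounded and
    Lipschitz on the whole of space-time, which gives uniqueness among all
    solutions, and continuously differentiable in space. Sums and products stay
    in this class, so the coefficients are treated term by term. *)
Definition C1_lip f : Prop :=
  [/\ forall p j, S p -> has_partial (Some j) f p,
      forall j, {within S, continuous (partial (Some j) f)} &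
      exists L : R, forall p, S p -> `|f p| <= L /\
        forall q, S q -> `|f p - f q| <= L * `|p - q|].

Lemma within_of_eq f g : {within S, continuous f} -> (forall p, S p -> f p = g p) ->
  {within S, continuous g}.
Proof.
move=> cf fg; apply: (subspace_eq_continuous _ cf) => p; rewrite inE; exact: fg.
Qed.

Lemma near_slice f g p : S p -> (forall q, S q -> f q = g q) ->
  \forall x \near p.1, f (x, p.2) = g (x, p.2).
Proof.
move=> [Dp p2] fg; have := open_nbhs_nbhs (conj hD Dp); apply: filterS => x Dx.
exact: fg.
Qed.

Lemma C1_lip_eq f g : (forall p, S p -> f p = g p) -> C1_lip f -> C1_lip g.
Proof.
move=> fg [df cdf [L hL]]; split.
- by move=> p j Sp; apply: near_eq_derivable (near_slice Sp fg) (df p j Sp).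
- move=> j; apply: within_of_eq (cdf j) _ => p Sp.
  exact/near_eq_derive/(near_slice Sp fg).
- exists L => p Sp; have [h1 h2] := hL p Sp; rewrite -fg //; split=> // q Sq.
  by rewrite -fg //; exact: h2.
Qed.

Lemma C1_lip_continuous f : C1_lip f -> {within S, continuous f}.
Proof.
move=> [_ _ [L hL]]; apply/subspace_continuousP => p Sp.
apply/cvgrPdist_le => eps eps0.
have near0 : (L * `|p - q|) @[q --> within S (nbhs p)] --> (0 : R).
  by apply: cvg_within_filter; exact: dist_cvg0.
have /cvgrPdist_le /(_ _ eps0) := near0; rewrite !nearE /within /=.
apply: filterS => q h Sq; move: (h Sq).
rewrite sub0r normrN => /(le_trans (ler_norm _)); apply: le_trans.
exact: (hL p Sp).2.
Qed.

Lemma within_curve f (z : R -> E) (tau : R -> R) : continuous z -> continuous tau ->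
  (forall s, S (z s, tau s)) -> {within S, continuous f} ->
  continuous (fun s => f (z s, tau s)).
Proof.
move=> cz ct Sz /subspace_continuousP cf s.
have cp : (fun s => (z s, tau s)) s' @[s' --> s] --> (z s, tau s).
  exact: cvg_pair (cz s) (ct s).
apply/cvgrPdist_le => e e0.
have /cvgrPdist_le /(_ e e0) := cf _ (Sz s); rewrite nearE /within /= => /cp h.
by near=> s'; have : S (z s', tau s') by []; near: s'.
Unshelve. all: by end_near. Qed.

Lemma C1_lip_cst (c : R) : C1_lip (cst c).
Proof.
split=> [p j _|j|]; first exact: derivable_cst.
  apply: (@within_of_eq (cst 0)); first exact: cst_continuous.
  by move=> p _; rewrite /partial /= derive_cst.
exists `|c| => p _; split=> // q _; rewrite subrr normr0 mulr_ge0 //.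
Qed.

Lemma C1_lipD f g : C1_lip f -> C1_lip g -> C1_lip (fun p => f p + g p).
Proof.
move=> [df cdf [L hL]] [dg cdg [M hM]]; split.
- move=> p j Sp; exact: derivableD (df p j Sp) (dg p j Sp).
- move=> j; apply: (@within_of_eq (fun p => partial (Some j) f p + partial (Some j) g p)).
    by move=> p; apply: cvgD; [exact: cdf|exact: cdg].
  by move=> p Sp; rewrite /partial -(deriveD (df p j Sp) (dg p j Sp)).
- exists (L + M) => p Sp; have [f1 f2] := hL p Sp; have [g1 g2] := hM p Sp.
  split; first exact: le_trans (ler_normD _ _) (lerD f1 g1).
  move=> q Sq; rewrite opprD addrACA mulrDl.
  exact: le_trans (ler_normD _ _) (lerD (f2 q Sq) (g2 q Sq)).
Qed.

Lemma C1_lipM f g : C1_lip f -> C1_lip g -> C1_lip (fun p => f p * g p).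
Proof.
move=> Hf Hg; have cf := C1_lip_continuous Hf; have cg := C1_lip_continuous Hg.
move: Hf Hg => [df cdf [L hL]] [dg cdg [M hM]]; split.
- move=> p j Sp; exact: derivableM (df p j Sp) (dg p j Sp).
- move=> j; apply: (@within_of_eq (fun p =>
    f p * partial (Some j) g p + g p * partial (Some j) f p)).
    by move=> p; apply: cvgD; apply: cvgM; [exact: cf|exact: cdg|exact: cg|exact: cdf].
  by move=> -[x s] Sp; rewrite /partial (deriveM (df _ j Sp) (dg _ j Sp)).
- exists (L * M + L * M) => p Sp; have [f1 f2] := hL p Sp; have [g1 g2] := hM p Sp.
  have LM : `|f p * g p| <= L * M by rewrite normrM ler_pM.
  have LM0 := le_trans (normr_ge0 _) LM.
  split; first by rewrite (le_trans LM) // lerDl.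
  move=> q Sq.
  have -> : f p * g p - f q * g q = f p * (g p - g q) + (f p - f q) * g q by ring.
  apply: (le_trans (ler_normD _ _)); rewrite [leRHS]mulrDl !normrM lerD //.
    by rewrite -mulrA ler_pM // g2.
  by rewrite mulrAC ler_pM // ?f2 // (hM q Sq).1.
Qed.

Lemma C1_lipZ (c : R) f : C1_lip f -> C1_lip (fun p => c * f p).
Proof. exact: C1_lipM (C1_lip_cst c). Qed.

Lemma C1_lip_sum m (f : 'I_m -> E * R -> R) :
  (forall k, C1_lip (f k)) -> C1_lip (fun p => \sum_(k < m) f k p).
Proof.
move=> hf; suff H (r : seq 'I_m) : C1_lip (fun p => \sum_(k <- r) f k p) by exact: H.
elim: r => [|k r IHr].
  by apply: C1_lip_eq (C1_lip_cst 0) => p _; rewrite big_nil.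
by apply: C1_lip_eq (C1_lipD (hf k) IHr) => p _; rewrite big_cons.
Qed.

(** The quotient of the time derivative only sees increments [h] with
    [0 <= t + h]; positive increments show that this filter is proper, so that
    limits along it are unique. *)
Lemma time_increments_proper (t : R) : 0 <= t -> ProperFilter (time_increments t).
Proof.
move=> t0; apply: Build_ProperFilter_ex => A [e /= e0 hA].
have : (0 : R)^'+ A.
  exists e => //= h he h0; apply: hA => //=; first by rewrite gt_eqF.
  by rewrite addr_ge0 // ltW.
exact: filter_ex.
Qed.

Lemma slice_sum m (f : 'I_m -> E * R -> R) (t : R) :
  (fun x : E => \sum_(k < m) f k (x, t)) = \sum_(k < m) (fun x : E => f k (x, t)).
Proof. by apply/funext => x; rewrite fct_sumE. Qed.

Lemma partial_sum a m (f : 'I_m -> E * R -> R) p : S p ->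
  (forall k, has_partial a (f k) p) ->
  partial a (fun q => \sum_(k < m) f k q) p = \sum_(k < m) partial a (f k) p.
Proof.
move=> [_ p2]; case: a => [j|] hf /=.
  by rewrite slice_sum (derive_sum hf).
have Ft := @time_increments_proper p.2 p2.
apply: cvg_lim => //.
have -> : time_quotient (fun q => \sum_(k < m) f k q) p =
    fun h => \sum_(k < m) time_quotient (f k) p h.
  apply/funext => h; rewrite /time_quotient -mulr_sumr; congr (_ * _).
  by rewrite -sumrB.
by apply: cvg_big => [|k _]; [exact: add_continuous|exact: hf].
Qed.

End SpacetimeCalculus.

(** * The coefficients of the Maxey-Riley system *)

Section MaxeyRileyFields.
Context {R : realType} {n : nat}.
Local Notation E := 'cV[R]_n.
Variables (D : set E) (u : E * R -> E).
Hypotheses (hD : open D) (hu : H2 D u).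
Local Notation S := (spacetime D).
Local Notation C1_lip := (C1_lip D).
Local Notation coord := Defs.coord.

(** A partial derivative of order at most three is bounded and Lipschitz by
    assumption; one more space derivative still exists and is continuous because
    the velocity is four times continuously differentiable. *)
Lemma H2_C1_lip i s : (size s <= 3)%N -> C1_lip (partials s (coord i u)).
Proof.
move=> s3; have [Ck bl] := hu; have [hp hc] := Ck i; have [bd lip] := bl i s s3.
split=> [p j Sp|j|]; [exact: hp|exact: (hc (Some j :: s))|].
have [L [L1 L2]] : exists L : R, (forall p, S p -> `|partials s (coord i u) p| <= L) /\
    (forall pq, (S `*` S) pq -> `|partials s (coord i u) pq.1 - partials s (coord i u) pq.2| <=
      L * `|pq.1 - pq.2|).
  by apply: (@filter_ex _ (pinfty_nbhs R)); apply: filterI; [exact: bd|exact: lip].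
by exists L => p Sp; split=> [|q Sq]; [exact: L1|exact: (L2 (p, q))].
Qed.

Lemma partial_laplacian a i p : S p ->
  partial a (coord i (laplacian u)) p =
  \sum_(k < n) partials [:: a; Some k; Some k] (coord i u) p.
Proof.
move=> Sp; pose f k := partials [:: Some k; Some k] (coord i u).
have -> : coord i (laplacian u) = fun q => \sum_(k < n) f k q.
  by apply/funext => q; rewrite /coord mxE.
apply: (@partial_sum _ _ D a n f p Sp) => k.
exact: ((hu.1 i).1 [:: Some k; Some k] a p isT Sp).
Qed.

Lemma laplacian_C1_lip i : C1_lip (coord i (laplacian u)).
Proof.
apply: C1_lip_eq (C1_lip_sum hD _) => // [p Sp|k].
  by rewrite /coord mxE; reflexivity.
exact: H2_C1_lip.
Qed.

Lemma partial_laplacian_C1_lip a i : C1_lip (partial a (coord i (laplacian u))).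
Proof.
apply: C1_lip_eq (C1_lip_sum hD _) => // [p Sp|k].
  by rewrite (partial_laplacian _ _ Sp); reflexivity.
exact: H2_C1_lip.
Qed.

Lemma material_C1_lip v i : (forall a, C1_lip (partial a (coord i v))) ->
  C1_lip (coord i (material u v)).
Proof.
move=> hv.
have hu0 k : C1_lip (coord k u) by exact: (@H2_C1_lip k [::]).
have conv := C1_lip_sum hD (fun k => C1_lipM (hv (Some k)) (hu0 k)).
apply: C1_lip_eq (C1_lipD (hv None) conv) => // p Sp.
by rewrite /coord !mxE; congr (_ + _); apply: eq_bigr => k _; rewrite mxE.
Qed.

Lemma A_field_C1_lip gamma mu i : C1_lip (coord i (A_field gamma mu u)).
Proof.
apply: C1_lip_eq (C1_lipD (H2_C1_lip i (s := [::]) isT)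
  (C1_lipZ (gamma / 6 * mu^-1) (laplacian_C1_lip i))) => // p Sp.
by rewrite /coord !mxE.
Qed.

Lemma M_field_C1_lip gamma mu i j : C1_lip (fun p => M_field gamma mu u p i j).
Proof.
apply: C1_lip_eq (C1_lipD (H2_C1_lip i (s := [:: Some j]) isT)
  (C1_lipZ (gamma / 6 * mu^-1) (partial_laplacian_C1_lip (Some j) i))) => // p Sp.
by rewrite !mxE.
Qed.

Lemma B_field_C1_lip Rr gamma mu g i : C1_lip (coord i (B_field Rr gamma mu g u)).
Proof.
have hM := C1_lip_sum hD (fun k => C1_lipM (M_field_C1_lip gamma mu i k)
  (laplacian_C1_lip k)).
have hmu : C1_lip (coord i (material u u)).
  by apply: material_C1_lip => a; exact: (@H2_C1_lip i [:: a]).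
have hml : C1_lip (coord i (material u (laplacian u))).
  by apply: material_C1_lip => a; exact: partial_laplacian_C1_lip.
apply: C1_lip_eq (C1_lipD (C1_lipD
  (C1_lipZ (3 * Rr / 2 - 1) (C1_lipD hmu (C1_lip_cst D (- g i 0))))
  (C1_lipZ ((Rr / 20 - 1 / 6) * gamma * mu^-1) hml))
  (C1_lipZ (- (gamma / 6 * mu^-1)) hM)) => // p Sp.
rewrite /coord /B_field; rewrite [in RHS]mxE [in RHS]mxE [X in _ = X + _ + _]mxE.
rewrite [X in _ = _ * X + _ + _]mxE [X in _ = _ * (_ + X) + _ + _]mxE.
rewrite [X in _ = _ + X + _]mxE [X in _ = _ + _ + X]mxE [X in _ = _ + _ - X]mxE.
by rewrite mulNr; congr (_ - _ * _); rewrite mxE.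
Qed.

End MaxeyRileyFields.

(** * First-order expansion, uniformly on a compact box *)

Section UniformModulus.
Context {R : realType} {n : nat}.
Local Notation E := 'cV[R]_n.
Variables (D : set E) (c : E) (rho t0 t1 : R).
Hypothesis hD : open D.
Hypothesis t00 : 0 <= t0.
Let K : set E := [set y | `|y - c| <= rho].
Hypothesis KD : K `<=` D.
Local Notation S := (spacetime D).

Let KI : set (E * R) := K `*` `[t0, t1].

Let KI_S p : KI p -> S p.
Proof.
by move=> [Kp /=]; rewrite in_itv /= => /andP[tp _]; split; [exact: KD|exact: le_trans tp].
Qed.

Lemma compact_box : compact KI.
Proof.
apply: compact_setX; last exact: segment_compact.
have trN (m p : nat) (v : 'M[R]_(m, p)) : `|v^T| <= `|v|.
  by apply: mx_norm_leP => // i j; rewrite mxE; exact: ler_mx_entry.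
have cT (m p : nat) : continuous (fun v : 'M[R]_(m, p) => v^T).
  by apply: (@lipschitz_continuous _ _ _ _ 1) => x y; rewrite mul1r -linearB trN.
have -> : K = (fun v : 'rV[R]_n => v^T) @` [set v | `|v^T - c| <= rho].
  apply/seteqP; split=> [y Ky|_ [v Kv <-] //]; exists y^T; rewrite ?trmxK //=.
  by rewrite trmxK.
apply: continuous_compact; first exact/continuous_subspaceT/cT.
apply: bounded_closed_compact.
  exists (rho + `|c|); split; first exact: num_real.
  move=> M hM v /= hv; apply/ltW/(le_lt_trans _ hM).
  rewrite -[v]trmxK; apply: (le_trans (trN _ _ _)).
  by rewrite -{1}(subrK c v^T); apply: (le_trans (ler_normD _ _)); rewrite lerD2r.
apply: (@preimage_closed _ _ (fun v : 'rV[R]_n => `|v^T - c|) [set x | x <= rho]);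
  last exact: closed_le.
move=> v _; apply: (@lipschitz_continuous _ _ R^o _ 1) => x y; rewrite mul1r.
apply: (le_trans (ler_dist_dist _ _)).
by rewrite opprD addrACA opprK addNr addr0 -linearB trN.
Qed.

(** Heine-Cantor on the compact box times the time interval, stated with an
    eventual modulus so that finitely many fields share the same one. *)
Lemma uniform_continuity (f : E * R -> R) : {within S, continuous f} ->
  forall e, 0 < e -> \forall eta \near (0 : R)^'+, forall y y' s, K y -> K y' ->
    s \in `[t0, t1] -> `|y' - y| <= eta -> `|f (y', s) - f (y, s)| <= e.
Proof.
move=> /subspace_continuousP cf e e0.
have e2 : 0 < e / 2 by rewrite divr_gt0.
have := compact_box; rewrite compact_near_coveringP => cov.
have := cov R (0 : R)^'+ (fun eta p => forall p', KI p -> KI p' ->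
  `|p' - p| <= eta -> `|f p' - f p| <= e) _ _.
case.
  move=> p0 Kp0; have Sp0 := KI_S Kp0.
  have /cvgrPdist_le /(_ _ e2) := cf p0 Sp0.
  rewrite nearE /within /= => /nbhs_ballP [r /= r0 hr].
  exists (ball p0 (r / 2), [set eta | 0 < eta < r / 2]).
    split; first by apply: nbhsx_ballx; rewrite divr_gt0.
    exists (r / 2) => /=; first by rewrite divr_gt0.
    by move=> x /=; rewrite sub0r normrN => + x0; rewrite gtr0_norm // x0.
  move=> [p eta] /= [pb /andP[eta0 etar]] p' Kp Kp' pp'.
  have hp : `|f p0 - f p| <= e / 2.
    apply: hr; last exact: KI_S.
    by apply: le_ball pb; lra.
  have hp' : `|f p0 - f p'| <= e / 2.
    apply: hr; last exact: KI_S.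
    move: pb; rewrite -!ball_normE /= => pb.
    rewrite -(subrK p p0) -addrA; apply: (le_lt_trans (ler_normD _ _)).
    by rewrite (distrC p p'); lra.
  rewrite -(subrK (f p0) (f p')) -addrA; apply: (le_trans (ler_normD _ _)).
  by rewrite (distrC (f p')); lra.
move=> r /= r0 hr; exists r => //= eta etar eta0 y y' s Ky Ky' sI yy'.
apply: (hr eta) => //=.
by rewrite pair_norm_le /= subrr normr0 yy' ltW.
Qed.

Lemma bounded_on_box (f : E * R -> R) : {within S, continuous f} ->
  exists2 m, 0 <= m & forall y s, K y -> s \in `[t0, t1] -> `|f (y, s)| <= m.
Proof.
move=> cf; have /compact_bounded [M [Mr hM]] : compact (f @` KI).
  apply: continuous_compact compact_box.
  by apply: continuous_subspaceW cf => p; exact: KI_S.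
exists (Num.max 0 (M + 1)); first by rewrite le_max lexx.
move=> y s Ky sI; apply: hM; last by exists (y, s).
by rewrite lt_max ltrDl ltr01 orbT.
Qed.

Lemma line_is_derive (f : E * R -> R) (y : E) (s th : R) (k : 'I_n) :
  C1_lip D f -> S (y + th *: delta_mx k 0, s) ->
  is_derive th 1 (fun th => f (y + th *: delta_mx k 0, s))
    (partial (Some k) f (y + th *: delta_mx k 0, s)).
Proof.
move=> [df _ _] Sy.
have E1 : (fun h : R => h^-1 *: (((fun th => f (y + th *: delta_mx k 0, s)) \o shift th)
      (h *: 1) - f (y + th *: delta_mx k 0, s))) =
    (fun h : R => h^-1 *: (((fun x : E => f (x, s)) \o shift (y + th *: delta_mx k 0))
      (h *: delta_mx k 0) - f (y + th *: delta_mx k 0, s))).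
  apply/funext => h /=; congr (_ *: (f (_, _) - _)).
  by rewrite scaler1 scalerDl addrCA.
split; first by rewrite /derivable E1; exact: (df _ k Sy).
by rewrite /derive E1.
Qed.

Lemma line_mvt (f : E * R -> R) (y : E) (s h : R) (k : 'I_n) : C1_lip D f ->
  (forall th, Num.min 0 h <= th <= Num.max 0 h -> S (y + th *: delta_mx k 0, s)) ->
  exists2 th, Num.min 0 h <= th <= Num.max 0 h &
    f (y + h *: delta_mx k 0, s) - f (y, s) =
    partial (Some k) f (y + th *: delta_mx k 0, s) * h.
Proof.
move=> hf Sy; pose g th := f (y + th *: delta_mx k 0, s).
have dg th : Num.min 0 h <= th <= Num.max 0 h ->
    is_derive th 1 g (partial (Some k) f (y + th *: delta_mx k 0, s)).
  by move=> /Sy; exact: line_is_derive.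
have cg : {within `[Num.min 0 h, Num.max 0 h], continuous g}.
  by apply: derivable_within_continuous => th; rewrite in_itv /= => /dg [].
have mM : Num.min 0 h <= Num.max 0 h by rewrite ge_min le_max lexx.
have dgo th : th \in `]Num.min 0 h, Num.max 0 h[ ->
    is_derive th 1 g (partial (Some k) f (y + th *: delta_mx k 0, s)).
  by rewrite in_itv /= => /andP[/ltW h1 /ltW h2]; apply: dg; rewrite h1.
have [th] := MVT_segment mM dgo cg.
rewrite in_itv /= => thI gE; exists th => //.
have -> : f (y, s) = g 0 by rewrite /g scale0r addr0.
rewrite -/(g h); move: gE; case: (leP 0 h) => _; rewrite ?subr0 //.
by rewrite sub0r mulrN => /eqP; rewrite -eqr_oppLR opprB => /eqP ->.
Qed.

(** Replace the coordinates of [y] by those of [y'] one at a time: each step is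
    a mean value along a coordinate line, and all intermediate points stay in
    the box because the norm is the maximum norm. *)
Lemma first_order_expansion (f : E * R -> R) e : C1_lip D f -> 0 < e ->
  \forall eta \near (0 : R)^'+, forall y y' s, K y -> K y' ->
    s \in `[t0, t1] -> `|y' - y| <= eta ->
    (forall j, `|partial (Some j) f (y', s) - partial (Some j) f (y, s)| <= e) /\
    `|f (y', s) - f (y, s) - \sum_(j < n) partial (Some j) f (y, s) * (y' - y) j 0| <=
      n%:R * e * `|y' - y|.
Proof.
move=> hf e0; have [_ cdf _] := hf.
have unif : \forall eta \near (0 : R)^'+, forall j y y' s, K y -> K y' ->
    s \in `[t0, t1] -> `|y' - y| <= eta ->
    `|partial (Some j) f (y', s) - partial (Some j) f (y, s)| <= e.
  by apply: filter_forall => j; exact: uniform_continuity (cdf j) e e0.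
near=> eta => y y' s Ky Ky' sI yy'.
have heta : forall j y y' s, K y -> K y' ->
    s \in `[t0, t1] -> `|y' - y| <= eta ->
    `|partial (Some j) f (y', s) - partial (Some j) f (y, s)| <= e by near: eta.
split; first by move=> j; exact: heta.
pose p (k : nat) : E := \col_i (if (i < k)%N then y' i 0 else y i 0).
have p0 : p 0%N = y by apply/colP => i; rewrite mxE.
have pn : p n = y' by apply/colP => i; rewrite mxE ltn_ord.
have pS (k : 'I_n) : p k.+1 = p k + (y' - y) k 0 *: delta_mx k 0.
  apply/colP => i; rewrite !mxE ltnS leq_eqVlt andbT eq_sym.
  case: eqVneq => [/val_inj ->|ik] /=.
    by rewrite ltnn eqxx mulr1 addrC subrK.
  by rewrite (_ : (i == k) = false) ?mulr0 ?addr0 //; apply: contra_neqF ik => /eqP ->.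
have hrho : 0 <= rho by apply: le_trans Ky.
have mid (k : 'I_n) th : Num.min 0 ((y' - y) k 0) <= th <= Num.max 0 ((y' - y) k 0) ->
    K (p k + th *: delta_mx k 0) /\ `|p k + th *: delta_mx k 0 - y| <= `|y' - y|.
  move=> hth; split; apply: mx_norm_leP => // i j; rewrite (ord1 j) {j}.
    have := le_trans (ler_mx_entry (y - c) i 0) Ky.
    have := le_trans (ler_mx_entry (y' - c) i 0) Ky'.
    rewrite !mxE !ler_norml andbT; case: eqVneq => [->|_] /=.
      rewrite ltnn mulr1; move: hth; rewrite !mxE.
      by case: (leP 0 (y' k 0 - y k 0)); lra.
    by rewrite mulr0 addr0; case: ifP.
  have := ler_mx_entry (y' - y) i 0.
  rewrite !mxE andbT; case: eqVneq => [->|_] /=.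
    rewrite ltnn mulr1 addrAC subrr add0r; apply: le_trans.
    move: hth; rewrite !mxE.
    case: (leP 0 (y' k 0 - y k 0)) => h /andP[h1 h2].
      by rewrite !ger0_norm.
    by rewrite (ltr0_norm h) (ler0_norm h2) lerN2.
  rewrite mulr0 addr0; case: ifP => // _ _.
  by rewrite subrr normr0.
have s0 : 0 <= s by move: sI; rewrite in_itv /= => /andP[+ _]; exact: le_trans.
have step (k : 'I_n) : `|f (p k.+1, s) - f (p k, s) -
    partial (Some k) f (y, s) * (y' - y) k 0| <= e * `|y' - y|.
  rewrite pS; have [|th thI ->] := @line_mvt f (p k) s ((y' - y) k 0) k hf.
    by move=> th /mid [+ _] => Kp; split => //=; exact: KD.
  have [Kp py] := mid k th thI.
  rewrite -mulrBl normrM ler_pM //; last exact: ler_mx_entry.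
  by apply: heta => //; exact: le_trans yy'.
have -> : f (y', s) - f (y, s) = \sum_(k < n) (f (p k.+1, s) - f (p k, s)).
  rewrite -(big_mkord xpredT (fun k => f (p k.+1, s) - f (p k, s))).
  by rewrite (telescope_sumr (fun k => f (p k, s))) // p0 pn.
rewrite -sumrB; apply: (le_trans (ler_norm_sum _ _ _)).
apply: (le_trans (ler_sum _ (fun k _ => step k))).
by rewrite sumr_const card_ord -mulrA mulr_natl.
Unshelve. all: by end_near. Qed.

End UniformModulus.

(** * Tools for the dependence on the initial condition *)

Section IntegralCongruence.
Context {R : realType} {n : nat}.
Local Notation E := 'cV[R]_n.
Local Notation V := (E * E)%type.

Lemma pair_integrableZ a b (k : R) (f : R -> V) :
  pair_integrable a b f -> pair_integrable a b (fun s => k *: f s).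
Proof.
by move=> [f1 f2]; split=> i;
  [apply: eq_integrable (integrableZl _ k (f1 i))
  |apply: eq_integrable (integrableZl _ k (f2 i))] => // s _;
  rewrite /= mxE.
Qed.

Lemma pair_integralZ a b (k : R) (f : R -> V) : pair_integrable a b f ->
  pair_integral a b (fun s => k *: f s) = k *: pair_integral a b f.
Proof.
move=> [f1 f2]; congr (_, _); apply/colP => i; rewrite !mxE.
  by rewrite -(RintegralZl k _ (f1 i)) //; apply: eq_Rintegral => s _; rewrite mxE.
by rewrite -(RintegralZl k _ (f2 i)) //; apply: eq_Rintegral => s _; rewrite mxE.
Qed.

Lemma eq_pair_integrable a b (f g : R -> V) : {in `[a, b], f =1 g} ->
  pair_integrable a b f -> pair_integrable a b g.
Proof.
move=> fg [f1 f2]; split=> i; [apply: eq_integrable (f1 i)|apply: eq_integrable (f2 i)] => //;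
  by move=> s; rewrite inE /= => sab; rewrite fg.
Qed.

Lemma eq_pair_integral a b (f g : R -> V) : {in `[a, b], f =1 g} ->
  pair_integral a b f = pair_integral a b g.
Proof.
by move=> fg; congr (_, _); apply/colP => i; rewrite !mxE; apply: eq_Rintegral => s;
  rewrite inE /= => sab; rewrite fg.
Qed.

Lemma eq_volterra t0 d (P P' F F' : R -> V -> V) z0 z :
  (forall s, s \in `[t0, t0 + d] -> P s (z s) = P' s (z s) /\ F s (z s) = F' s (z s)) ->
  volterra_solution t0 d P F z0 z -> volterra_solution t0 d P' F' z0 z.
Proof.
move=> H sol t tI; have [fi ->] := sol t tI.
have eqf : {in `[t0, t], abel_integrand P F z t =1 abel_integrand P' F' z t}.
  move=> s; move: tI; rewrite !in_itv /= => /andP[_ td] /andP[t0s st].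
  have [|e1 e2] := H s; first by rewrite in_itv /= t0s (le_trans st).
  by rewrite /abel_integrand e1 e2.
by split; [exact: eq_pair_integrable fi|rewrite (eq_pair_integral eqf)].
Qed.

End IntegralCongruence.

Section BoxProjection.
Context {R : realType} {n : nat}.
Local Notation E := 'cV[R]_n.
Local Notation V := (E * E)%type.
Implicit Types (c x y : E) (z : V) (rho : R).

(** Because the norm is the maximum norm, the closed ball is a box and truncating
    each coordinate is a nonexpansive retraction onto it. *)
Definition box_proj c rho y : E :=
  \col_i clamp (c i 0 - rho) (c i 0 + rho) (y i 0).

Lemma box_proj_lipschitz c rho x y : `|box_proj c rho x - box_proj c rho y| <= `|x - y|.
Proof.
apply: mx_norm_leP => // i j; rewrite !mxE.
apply: (le_trans (clamp_lipschitz _ _ _ _)).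
by have := ler_mx_entry (x - y) i 0; rewrite !mxE.
Qed.

Lemma box_proj_in c rho y : 0 <= rho -> `|box_proj c rho y - c| <= rho.
Proof.
move=> rho0; apply: mx_norm_leP => // i j; rewrite !mxE (ord1 j).
have /(@clamp_itv _ _ _ (y i 0)) : c i 0 - rho <= c i 0 + rho by lra.
by rewrite ler_norml; lra.
Qed.

Lemma box_proj_id c rho y : `|y - c| <= rho -> box_proj c rho y = y.
Proof.
move=> yc; apply/colP => i; rewrite !mxE; apply: clamp_id.
by have := le_trans (ler_mx_entry (y - c) i 0) yc; rewrite !mxE ler_norml; lra.
Qed.

Definition pair_proj (c : V) rho z : V := (box_proj c.1 rho z.1, box_proj c.2 rho z.2).

Lemma pair_proj_lipschitz (c : V) rho z z' :
  `|pair_proj c rho z - pair_proj c rho z'| <= `|z - z'|.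
Proof.
rewrite pair_norm_le /=; apply/andP; split; apply: (le_trans (box_proj_lipschitz _ _ _ _)).
  exact: (ler_norm1 (z - z')).
exact: (ler_norm2 (z - z')).
Qed.

Lemma pair_proj_in (c : V) rho z : 0 <= rho -> `|pair_proj c rho z - c| <= rho.
Proof. by move=> rho0; rewrite pair_norm_le /= !box_proj_in. Qed.

Lemma pair_proj_id (c : V) rho z : `|z - c| <= rho -> pair_proj c rho z = z.
Proof.
by rewrite pair_norm_le => /andP[z1 z2]; rewrite /pair_proj !box_proj_id //; case: z {z1 z2}.
Qed.

End BoxProjection.

Section Differentiation.
Context {R : realType} {V W : normedModType R}.

Lemma differentiable_of_estimate (f : V -> W) (df : V -> W) (x : V) (M : R) :
  linear df -> (forall h, `|df h| <= M * `|h|) ->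
  (forall e, 0 < e -> \forall h \near 0, `|f (x + h) - f x - df h| <= e * `|h|) ->
  differentiable f x /\ 'd f x = df :> (V -> W).
Proof.
move=> ldf bdf est.
pose dfl : {linear V -> W} := HB.pack df (GRing.isLinear.Build R V W _ df ldf).
have cdf : continuous dfl.
  apply: (@lipschitz_continuous _ _ _ _ M) => a b.
  by rewrite -linearB; exact: bdf.
have fE : f \o shift x = cst (f x) + dfl +o_ 0 id.
  apply/eqaddoP => e e0; apply: filterS (est e e0) => h.
  have -> : (f \o shift x - (cst (f x) + dfl)) h = f (h + x) - (f x + df h) by [].
  by rewrite opprD addrA (addrC h).
have dE := diff_unique cdf fE.
by split=> //; apply/diff_locallyP; rewrite dE.
Qed.

(** Stated for abstract normed modules: the derivative is then identified once,
    and on pairs of vectors only norm estimates remain. *)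
Lemma C1_on_of_estimate (U : set V) (f : V -> W) (df : V -> V -> W) (M : R) :
  (forall x, U x -> linear (df x)) ->
  (forall x h, U x -> `|df x h| <= M * `|h|) ->
  (forall x e, U x -> 0 < e ->
    \forall h \near 0, `|f (x + h) - f x - df x h| <= e * `|h|) ->
  (forall x e, U x -> 0 < e -> \forall x' \near x,
    U x' /\ forall h, `|df x' h - df x h| <= e * `|h|) ->
  C1_on U f.
Proof.
move=> ldf bdf est cont.
have H x : U x -> differentiable f x /\ 'd f x = df x :> (V -> W).
  move=> Ux; apply: (@differentiable_of_estimate f (df x) x M) => [|h|e e0].
  - exact: ldf.
  - exact: bdf.
  - exact: est.
split=> [x /H []//|x Ux e e0]; apply: filterS (cont x e Ux e0) => x' [Ux' h1] h.
by rewrite (H x Ux).2 (H x' Ux').2.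
Qed.

End Differentiation.

Lemma small_time {R : realType} (C N rho : R) : 0 <= C -> 0 <= N -> 0 < rho ->
  exists d : R, [/\ 0 < d, d <= 1, C * (2 * Num.sqrt d) + C * d <= 2^-1 &
    N * (2 * Num.sqrt d) + N * d <= rho / 2].
Proof.
move=> C0 N0 rho0.
(* For [d = r ^ 2] with [r <= 1], the sum [2 sqrt d + d] is at most [3 r], so
   it suffices that [3 C r <= 1 / 2] and [3 N r <= rho / 2]. *)
pose r : R := Num.min 1 (Num.min (6 * (C + 1))^-1 (rho / (6 * (N + 1)))).
have C1 : 0 < 6 * (C + 1) by rewrite mulr_gt0 // ltr_wpDl.
have N1 : 0 < 6 * (N + 1) by rewrite mulr_gt0 // ltr_wpDl.
have r0 : 0 < r by rewrite !lt_min ltr01 invr_gt0 C1 divr_gt0.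
have r1 : r <= 1 by rewrite ge_min lexx.
have rC : r * (6 * (C + 1)) <= 1.
  by rewrite -ler_pdivlMr // mul1r !ge_min lexx orbT.
have rN : r * (6 * (N + 1)) <= rho.
  by rewrite -ler_pdivlMr // !ge_min lexx !orbT.
have rr : r ^+ 2 <= r by rewrite expr2 ler_piMl // ltW.
exists (r ^+ 2); rewrite sqrtr_sqr gtr0_norm //; split.
- exact: exprn_gt0.
- exact: le_trans rr r1.
- have : C * r ^+ 2 <= C * r by rewrite ler_wpM2l.
  by nra.
- have : N * r ^+ 2 <= N * r by rewrite ler_wpM2l.
  by nra.
Qed.

Section LinearMaps.
Context {R : realType} {V W : normedModType R} (f : V -> W).
Hypothesis lf : linear f.
Let fl : {linear V -> W} := HB.pack f (GRing.isLinear.Build R V W _ f lf).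

Lemma linear_sub x y : f (x - y) = f x - f y.
Proof. exact: (linearB fl). Qed.

Lemma linear_scale k x : f (k *: x) = k *: f x.
Proof. exact: (linearZ_LR fl). Qed.

Lemma sub_scaled_add (k : R) (x1 x2 x3 y1 y2 y3 : V) :
  (x1 + y1) - k *: (x2 + y2) - (x3 + y3) = (x1 - k *: x2 - x3) + (y1 - k *: y2 - y3).
Proof. by rewrite scalerDr !opprD (addrACA x1 y1) [LHS]addrACA. Qed.

Lemma sub_add3 (x1 x2 x3 y1 y2 y3 : V) :
  (x1 + y1) - (x2 + y2) - (x3 + y3) = (x1 - x2 - x3) + (y1 - y2 - y3).
Proof. by rewrite !opprD (addrACA x1 y1) [LHS]addrACA. Qed.

End LinearMaps.

Lemma remainder_le {R : realType} (e d x : R) : 0 <= e -> d <= 1 -> 0 <= x ->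
  2 * (0 + e / 4 * (2 * x) * d) <= e * x.
Proof.
move=> e0 d1 x0; rewrite add0r.
have : 0 <= (e * x) * (1 - d) by rewrite !mulr_ge0 ?subr_ge0.
by lra.
Qed.

(** * Continuous differentiability in the initial condition *)

Section SmoothDependence.
Context {R : realType} {n : nat}.
Local Notation E := 'cV[R]_n.
Local Notation V := (E * E)%type.
Variables (D : set E) (c : V) (rho t0 C N : R).
Variables (L : V -> V) (G : R -> V -> V) (dG : R -> V -> V -> V).
Let K : set V := [set z | `|z - c| <= rho].
Let tau : R -> R := clamp_time t0 1.
Local Notation I1 := `[t0, t0 + 1].
Hypotheses (rho0 : 0 < rho) (C0 : 0 <= C) (N0 : 0 <= N).
Hypothesis KD : forall z, K z -> D z.1.
Hypothesis L_lin : linear L.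
Hypothesis L_le : forall z, `|L z| <= C * `|z|.
Hypothesis G_cont : forall z : R -> V, continuous z -> (forall s, K (z s)) ->
  continuous (fun s => G (tau s) (z s)).
Hypothesis dG_cont : forall z v : R -> V, continuous z -> (forall s, K (z s)) ->
  continuous v -> continuous (fun s => dG (tau s) (z s) (v s)).
Hypothesis G_lip : forall s z z', s \in I1 -> K z -> D z'.1 ->
  `|G s z' - G s z| <= C * `|z' - z|.
Hypothesis dG_lin : forall s z, linear (dG s z).
Hypothesis dG_le : forall s z v, s \in I1 -> K z -> `|dG s z v| <= C * `|v|.
Hypothesis G_expand : forall e, 0 < e -> \forall eta \near (0 : R)^'+,
  forall s z z', s \in I1 -> K z -> K z' -> `|z' - z| <= eta ->
  `|G s z' - G s z - dG s z (z' - z)| <= e * `|z' - z| /\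
  forall v, `|dG s z' v - dG s z v| <= e * `|v|.
Hypothesis L_bound : forall z, K z -> `|L z| <= N.
Hypothesis G_bound : forall s z, s \in I1 -> K z -> `|G s z| <= N.

Let tau_in s : tau s \in I1.
Proof. exact: clamp_time_in. Qed.

Let LB z z' : L (z - z') = L z - L z'.
Proof. exact: linear_sub. Qed.

Let dGB s z v v' : dG s z (v - v') = dG s z v - dG s z v'.
Proof. exact: linear_sub. Qed.

Let L_cont (z : R -> V) : continuous z -> continuous (fun s => L (z s)).
Proof.
move=> cz s; apply: (continuous_comp (cz s)).
by apply: (@lipschitz_continuous _ _ _ _ C) => x y; rewrite -LB.
Qed.

Let pi : V -> V := pair_proj c rho.

Let pi_in z : K (pi z).
Proof. exact/pair_proj_in/ltW. Qed.

Let pi_id z : K z -> pi z = z.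
Proof. exact: pair_proj_id. Qed.

Let pi_cont (z : R -> V) : continuous z -> continuous (fun s => pi (z s)).
Proof.
move=> cz s; apply: (continuous_comp (cz s)).
by apply: (@lipschitz_continuous _ _ _ _ 1) => x y; rewrite mul1r pair_proj_lipschitz.
Qed.

Let P (s : R) (z : V) : V := L (pi z).
Let F (s : R) (z : V) : V := G (tau s) (pi z).

(** The truncated equation, with [pi] inserted, has globally Lipschitz
    coefficients and is solvable from every initial condition. For initial
    conditions near [c] its solutions stay in the box; there the truncation
    disappears. The hypothesis [G_lip] compares a point of the box with any
    point over [D], because uniqueness is claimed among all solutions in [D]. *)
Theorem C1_dependence : exists d : R, [/\ 0 < d, d <= 1 &
  exists (U : set V) (Phi : V -> R -> V),
  [/\ open_nbhs c U,
      forall z0, U z0 -> D z0.1,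
      forall z0, U z0 -> [/\ continuous (Phi z0),
        forall t, t \in `[t0, t0 + d] -> D (Phi z0 t).1 &
        volterra_solution t0 d (fun=> L) G z0 (Phi z0)],
      forall z0 z, U z0 -> {within `[t0, t0 + d], continuous z} ->
        (forall t, t \in `[t0, t0 + d] -> D (z t).1) ->
        volterra_solution t0 d (fun=> L) G z0 z ->
        forall t, t \in `[t0, t0 + d] -> z t = Phi z0 t &
      forall t, t \in `[t0, t0 + d] -> C1_on U (Phi ^~ t)]].
Proof.
have [d [d0 d1 dC dN]] := small_time C0 N0 rho0.
have dge0 := ltW d0.
exists d; split=> //.
have sm : abel_small d C C by split.
have I_tau s : s \in `[t0, t0 + d] -> tau s = s.
  rewrite in_itv /= => /andP[t0s sd]; apply: clamp_time_id.
  by rewrite in_itv /= t0s (le_trans sd) // lerD2l.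
have I_1 s : s \in `[t0, t0 + d] -> s \in I1.
  by move=> /I_tau <-; exact: tau_in.
have P_lip s z z' : `|P s z - P s z'| <= C * `|z - z'|.
  rewrite -LB; apply: (le_trans (L_le _)); rewrite ler_wpM2l //.
  exact: pair_proj_lipschitz.
have F_lip s z z' : `|F s z - F s z'| <= C * `|z - z'|.
  apply: (@le_trans _ _ (C * `|pi z - pi z'|)); first by apply: G_lip => //; exact/KD/pi_in.
  by rewrite ler_wpM2l //; exact: pair_proj_lipschitz.
have P_cont z : continuous z -> continuous (fun s => P s (z s)).
  by move=> /pi_cont /L_cont.
have F_cont z : continuous z -> continuous (fun s => F s (z s)).
  by move=> cz; exact: (@G_cont (fun s => pi (z s)) (@pi_cont z cz) (fun s => pi_in _)).
have /choice [Phi hPhi] : forall z0, exists z, continuous z /\ volterra_solution t0 d P F z0 z.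
  move=> z0; have [z cz sz] := volterra_exists t0 dge0 P_cont F_cont P_lip F_lip sm z0.
  by exists z.
have Phi_cont z0 : continuous (Phi z0) by case: (hPhi z0).
have Phi_sol z0 : volterra_solution t0 d P F z0 (Phi z0) by case: (hPhi z0).
have bnd (z : R -> V) : {within `[t0, t0 + d], continuous z} ->
    exists M, forall t, t \in `[t0, t0 + d] -> `|z t| <= M.
  by move=> /within_continuous_bounded [M _ hM]; exists M.
have bndB (z z' : R -> V) : (exists M, forall t, t \in `[t0, t0 + d] -> `|z t| <= M) ->
    (exists M, forall t, t \in `[t0, t0 + d] -> `|z' t| <= M) ->
    exists M, forall t, t \in `[t0, t0 + d] -> `|z t - z' t| <= M.
  move=> [M hM] [M' hM']; exists (M + M') => t tI.
  by apply: (le_trans (ler_normB _ _)); rewrite lerD ?hM ?hM'.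
have Phi_bnd z0 := bnd _ (continuous_subspaceT (@Phi_cont z0)).
have sub s t : t \in `[t0, t0 + d] -> t0 <= s < t -> s \in `[t0, t0 + d].
  rewrite !in_itv /= => /andP[_ td] /andP[-> st] /=.
  exact: le_trans (ltW st) td.
have kernel_le t s (x y : V) m1 m2 : `|x| <= m1 -> `|y| <= m2 ->
    `|abel_kernel t s *: x + y| <= m1 * abel_kernel t s + m2.
  move=> xm ym; apply: (le_trans (ler_normD _ _)); rewrite normrZ.
  by rewrite ger0_norm ?abel_kernel_ge0 // mulrC lerD // ler_wpM2r ?abel_kernel_ge0.
(* From the half ball, solutions cannot leave the box within time [d], so
   they solve the equation without truncation. *)
pose U : set V := ball c (rho / 2).
have U_in z0 : U z0 -> `|z0 - c| <= rho / 2.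
  by rewrite /U -ball_normE /= distrC => /ltW.
have U_K z0 t : U z0 -> t \in `[t0, t0 + d] -> K (Phi z0 t).
  move=> Uz tI; have [fi ->] := Phi_sol z0 t tI; rewrite /K /=.
  rewrite addrAC; apply: (le_trans (ler_normD _ _)).
  rewrite [leRHS]splitr lerD ?U_in //; apply: le_trans dN.
  move: (tI); rewrite in_itv /= => /andP[t0t td].
  apply: (@le_trans _ _ (N * (2 * Num.sqrt (t - t0) - 2 * Num.sqrt (t - t)) + N * (t - t0))).
    apply: pair_integral_abel_le => // s _; apply: kernel_le.
      exact/L_bound/pi_in.
    by apply: G_bound; [exact: tau_in|exact: pi_in].
  have td' : t - t0 <= d by rewrite lerBlDl.
  rewrite subrr sqrtr0 mulr0 subr0 lerD ?ler_wpM2l //.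
  by rewrite ler_sqrt.
have U_sol z0 : U z0 -> volterra_solution t0 d (fun=> L) G z0 (Phi z0).
  move=> Uz; apply: eq_volterra (Phi_sol z0) => s sI.
  by rewrite /P /F pi_id ?I_tau //; exact: U_K.
have Phi_lip z0 z0' t : t \in `[t0, t0 + d] -> `|Phi z0' t - Phi z0 t| <= 2 * `|z0' - z0|.
  move=> tI; rewrite -[leRHS](_ : 2 * (`|z0' - z0| + 0 * d) = _); last by rewrite mul0r addr0.
  apply: (@abel_stability _ _ t0 d dge0 (fun t => Phi z0' t - Phi z0 t) (cst (z0' - z0))
    (fun t s => abel_integrand P F (Phi z0') t s - abel_integrand P F (Phi z0) t s) C C) => //.
  - exact: bndB.
  - move=> u uI; have [i1 e1] := Phi_sol z0' u uI; have [i2 e2] := Phi_sol z0 u uI.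
    split; first exact: pair_integrableB.
    by rewrite pair_integralB // e1 e2 opprD addrACA.
  - move=> u s uI sI; rewrite /abel_integrand opprD addrACA -scalerBr addr0.
    exact: kernel_le.
have unique z0 z : U z0 -> {within `[t0, t0 + d], continuous z} ->
    (forall t, t \in `[t0, t0 + d] -> D (z t).1) ->
    volterra_solution t0 d (fun=> L) G z0 z ->
    forall t, t \in `[t0, t0 + d] -> z t = Phi z0 t.
  move=> Uz cz Dz sol t tI; apply/eqP; rewrite -subr_eq0 -normr_le0.
  rewrite -[leRHS](_ : 2 * (0 + 0 * d) = _); last by rewrite mul0r addr0 mulr0.
  apply: (@abel_stability _ _ t0 d dge0 (fun t => z t - Phi z0 t) (cst 0)
    (fun t s => abel_integrand (fun=> L) G z t s -
                abel_integrand (fun=> L) G (Phi z0) t s) C C) => //.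
  - by apply: bndB => //; exact: bnd.
  - by move=> u _; rewrite normr0.
  - move=> u uI; have [i1 e1] := sol u uI; have [i2 e2] := U_sol z0 Uz u uI.
    split; first exact: pair_integrableB.
    by rewrite pair_integralB // e1 e2 opprD addrACA subrr.
  - move=> u s uI sI; have {}sI := sub _ _ uI sI.
    rewrite /abel_integrand opprD addrACA -scalerBr addr0 -LB.
    by apply: kernel_le => //; apply: G_lip; [exact: I_1|exact: U_K|exact: Dz].
(* The candidate derivative [W (z0, h)] solves the equation linearized along the
   solution from [z0], with initial condition [h]. *)
pose dF z0 s v := dG (tau s) (pi (Phi z0 s)) v.
have dF_lip z0 s v v' : `|dF z0 s v - dF z0 s v'| <= C * `|v - v'|.
  by rewrite /dF -dGB; apply: dG_le; [exact: tau_in|exact: pi_in].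
have L_lip (s : R) v v' : `|L v - L v'| <= C * `|v - v'| by rewrite -LB.
have dF_cont z0 v : continuous v -> continuous (fun s => dF z0 s (v s)).
  exact: (@dG_cont (fun s => pi (Phi z0 s)) v (@pi_cont _ (@Phi_cont z0)) (fun s => pi_in _)).
have /choice [W hW] : forall zh : V * V, exists v, continuous v /\
    volterra_solution t0 d (fun=> L) (dF zh.1) zh.2 v.
  by move=> zh; have [v cv sv] := volterra_exists t0 dge0 L_cont
    (@dF_cont zh.1) L_lip (dF_lip zh.1) sm zh.2; exists v.
have W_cont z0 h : continuous (W (z0, h)) by case: (hW (z0, h)).
have W_sol z0 h : volterra_solution t0 d (fun=> L) (dF z0) h (W (z0, h)).
  by case: (hW (z0, h)).
have W_bnd z0 h := bnd _ (continuous_subspaceT (@W_cont z0 h)).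
have W_le z0 h t : t \in `[t0, t0 + d] -> `|W (z0, h) t| <= 2 * `|h|.
  move=> tI; rewrite -[leRHS](_ : 2 * (`|h| + 0 * d) = _); last by rewrite mul0r addr0.
  apply: (@abel_stability _ _ t0 d dge0 (W (z0, h)) (cst h)
    (abel_integrand (fun=> L) (dF z0) (W (z0, h))) C C) => //.
    exact: W_sol.
  move=> u s uI sI; rewrite addr0; apply: kernel_le => //.
  by apply: dG_le; [exact: tau_in|exact: pi_in].
have W_lin z0 t : t \in `[t0, t0 + d] -> linear (fun h => W (z0, h) t).
  move=> tI k h h'; apply/eqP; rewrite -subr_eq0 opprD addrA -normr_le0.
  rewrite -[leRHS](_ : 2 * (0 + 0 * d) = _); last by rewrite mul0r addr0 mulr0.
  pose a x := abel_integrand (fun=> L) (dF z0) (W (z0, x)).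
  apply: (@abel_stability _ _ t0 d dge0
    (fun t => W (z0, k *: h + h') t - k *: W (z0, h) t - W (z0, h') t) (cst 0)
    (fun t s => a (k *: h + h') t s - k *: a h t s - a h' t s) C C) => //.
  - apply: (bndB _ _ (bndB _ _ (W_bnd _ _) _) (W_bnd _ _)).
    have [M hM] := W_bnd z0 h.
    by exists (`|k| * M) => u uI; rewrite normrZ ler_wpM2l ?hM.
  - by move=> u _; rewrite normr0.
  - move=> u uI; have [i1 e1] := W_sol z0 (k *: h + h') u uI.
    have [i2 e2] := W_sol z0 h u uI; have [i3 e3] := W_sol z0 h' u uI.
    have i2' := pair_integrableZ k i2; have i12 := pair_integrableB i1 i2'.
    split; first exact: pair_integrableB i12 i3.
    rewrite (pair_integralB i12 i3) (pair_integralB i1 i2') pair_integralZ //.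
    rewrite e1 e2 e3 sub_scaled_add; congr (_ + _).
    by rewrite (addrAC (k *: h) h') subrr add0r subrr.
  - move=> u s uI sI; rewrite addr0.
    rewrite /a /abel_integrand sub_scaled_add.
    have -> : k *: (abel_kernel u s *: L (W (z0, h) s)) =
        abel_kernel u s *: (k *: L (W (z0, h) s)).
      by rewrite !scalerA (mulrC k).
    rewrite -!scalerBr -(linear_scale L_lin) -(linear_scale (dG_lin _ _)) -!LB -!dGB.
    by apply: kernel_le => //; apply: dG_le; [exact: tau_in|exact: pi_in].
have modulus e : 0 < e -> exists2 eta, 0 < eta & forall s z z', s \in I1 ->
    K z -> K z' -> `|z' - z| <= eta ->
    `|G s z' - G s z - dG s z (z' - z)| <= e * `|z' - z| /\
    forall v, `|dG s z' v - dG s z v| <= e * `|v|.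
  move=> e0; have [eta [h1 h2]] := filter_ex (filterI (nbhs_right_gt 0) (G_expand e0)).
  by exists eta.
have near_U z0 eta : U z0 -> 0 < eta ->
    \forall z \near z0, U z /\ `|z - z0| <= eta.
  move=> Uz eta0; apply: filterI.
    by apply: open_nbhs_nbhs; split=> //; exact: ball_open.
  have := nbhsx_ballx z0 _ eta0; apply: filterS => z.
  by rewrite -ball_normE /= distrC => /ltW.
have Phi_near z0 t e : U z0 -> t \in `[t0, t0 + d] -> 0 < e ->
    \forall h \near (0 : V), `|Phi (z0 + h) t - Phi z0 t - W (z0, h) t| <= e * `|h|.
  move=> Uz tI e0.
  have e4 : 0 < e / 4 by rewrite divr_gt0.
  have [eta eta0 heta] := modulus _ e4.
  have eta2 : 0 < eta / 2 by rewrite divr_gt0.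
  have near_h : \forall h \near (0 : V), U (z0 + h) /\ `|h| <= eta / 2.
    have := near_U z0 _ Uz eta2; rewrite (near_shift 0); apply: filterS => h /=.
    by rewrite subr0 addrK addrC.
  apply: filterS near_h => h [Uh hh].
  apply: (@le_trans _ _ (2 * (0 + e / 4 * (2 * `|h|) * d))); last first.
    by apply: remainder_le => //; exact: ltW.
  apply: (@abel_stability _ _ t0 d dge0
    (fun t => Phi (z0 + h) t - Phi z0 t - W (z0, h) t) (cst 0)
    (fun t s => abel_integrand (fun=> L) G (Phi (z0 + h)) t s -
                abel_integrand (fun=> L) G (Phi z0) t s -
                abel_integrand (fun=> L) (dF z0) (W (z0, h)) t s) C C) => //.
  - by rewrite !mulr_ge0 // ltW.
  - exact: (bndB _ _ (bndB _ _ (Phi_bnd _) (Phi_bnd _)) (W_bnd _ _)).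
  - by move=> u _; rewrite normr0.
  - move=> u uI; have [i1 e1] := U_sol _ Uh u uI; have [i2 e2] := U_sol _ Uz u uI.
    have [i3 e3] := W_sol z0 h u uI; have i12 := pair_integrableB i1 i2.
    split; first exact: pair_integrableB i12 i3.
    rewrite (pair_integralB i12 i3) (pair_integralB i1 i2) e1 e2 e3 add0r.
    by rewrite sub_add3 (addrAC z0 h) subrr add0r subrr add0r.
  - move=> u s uI sI; have {}sI := sub _ _ uI sI.
    rewrite /abel_integrand sub_add3 -!scalerBr -!LB /dF I_tau //.
    have KPhi := U_K _ s Uz sI; have KPhi' := U_K _ s Uh sI.
    rewrite pi_id //; apply: kernel_le => //.
    have PhiB : `|Phi (z0 + h) s - Phi z0 s| <= 2 * `|h|.
      by have := Phi_lip z0 (z0 + h) s sI; rewrite (addrAC z0 h) subrr add0r.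
    have [|Gx _] := heta s _ _ (I_1 _ sI) KPhi KPhi'.
      by apply: (le_trans PhiB); rewrite mulrC -ler_pdivlMr.
    (* Split into the error of the expansion of [G] and [dG] of the remainder. *)
    rewrite -(subrK (dG s (Phi z0 s) (Phi (z0 + h) s - Phi z0 s))
      (G s (Phi (z0 + h) s) - G s (Phi z0 s))) -addrA -dGB addrC.
    apply: (le_trans (ler_normD _ _)); rewrite lerD //.
      by apply: dG_le => //; exact: I_1.
    by apply: (le_trans Gx); rewrite ler_wpM2l // ltW.
have W_near z0 t e : U z0 -> t \in `[t0, t0 + d] -> 0 < e ->
    \forall z1 \near z0, U z1 /\ forall h, `|W (z1, h) t - W (z0, h) t| <= e * `|h|.
  move=> Uz tI e0.
  have e4 : 0 < e / 4 by rewrite divr_gt0.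
  have [eta eta0 heta] := modulus _ e4.
  have eta2 : 0 < eta / 2 by rewrite divr_gt0.
  apply: filterS (near_U z0 _ Uz eta2) => z1 [Uz1 z1z0].
  split=> // h.
  apply: (@le_trans _ _ (2 * (0 + e / 4 * (2 * `|h|) * d))); last first.
    by apply: remainder_le => //; exact: ltW.
  apply: (@abel_stability _ _ t0 d dge0
    (fun t => W (z1, h) t - W (z0, h) t) (cst 0)
    (fun t s => abel_integrand (fun=> L) (dF z1) (W (z1, h)) t s -
                abel_integrand (fun=> L) (dF z0) (W (z0, h)) t s) C C) => //.
  - by rewrite !mulr_ge0 // ltW.
  - exact: (bndB _ _ (W_bnd _ _) (W_bnd _ _)).
  - by move=> u _; rewrite normr0.
  - move=> u uI; have [i1 e1] := W_sol z1 h u uI; have [i2 e2] := W_sol z0 h u uI.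
    split; first exact: pair_integrableB i1 i2.
    by rewrite (pair_integralB i1 i2) e1 e2 opprD addrACA subrr.
  - move=> u s uI sI; have {}sI := sub _ _ uI sI.
    rewrite /abel_integrand opprD addrACA -scalerBr -LB /dF I_tau //.
    have K0 := U_K _ s Uz sI; have K1 := U_K _ s Uz1 sI.
    rewrite !pi_id //; apply: kernel_le => //.
    have [|_ Gv] := heta s _ _ (I_1 _ sI) K0 K1.
      apply: (le_trans (Phi_lip z0 z1 s sI)).
      by rewrite mulrC -ler_pdivlMr.
    (* Split into the variation of [dG] along the two solutions and [dG] of the
       difference of the two linearized solutions. *)
    rewrite -(subrK (dG s (Phi z0 s) (W (z1, h) s)) (dG s (Phi z1 s) (W (z1, h) s))).
    rewrite -addrA -dGB addrC.
    apply: (le_trans (ler_normD _ _)); rewrite lerD //.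
      by apply: dG_le => //; exact: I_1.
    by apply: (le_trans (Gv _)); rewrite ler_wpM2l ?(ltW e4) // W_le.
exists U, Phi; split=> //.
- by split; [exact: ball_open|exact: ballxx (divr_gt0 _ _)].
- move=> z0 /U_in h; apply: KD; rewrite /K /=; apply: (le_trans h).
  by rewrite ler_pdivrMr // ler_peMr ?ltW // ltr1n.
- move=> z0 Uz; split=> //; last exact: U_sol.
  by move=> t tI; exact/KD/U_K.
- move=> t tI; apply: (@C1_on_of_estimate _ _ _ _ _ (fun z h => W (z, h) t) 2).
  + by move=> z _; exact: W_lin.
  + by move=> z h _; exact: W_le.
  + by move=> z e Uz e0; exact: Phi_near.
  + by move=> z e Uz e0; exact: W_near.
Qed.

End SmoothDependence.

(** * Matrix-valued fields *)

Section MatrixContinuity.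
Context {R : realType}.

Lemma mx_continuous (T : topologicalType) m q (X : T -> 'M[R]_(m, q)) :
  (forall i j, continuous (fun s => X s i j)) -> continuous X.
Proof.
move=> cX s; apply/cvgrPdist_le => e e0.
have : \forall s' \near s, forall ij : 'I_m * 'I_q, `|X s ij.1 ij.2 - X s' ij.1 ij.2| <= e.
  by apply: filter_forall => ij; have /cvgrPdist_le := cX ij.1 ij.2 s; exact.
apply: filterS => s' h; apply: mx_norm_leP => [|i j]; first exact: ltW.
by rewrite !mxE; exact: (h (i, j)).
Qed.

Lemma entry_continuous (T : topologicalType) m q (X : T -> 'M[R]_(m, q)) i j :
  continuous X -> continuous (fun s => X s i j).
Proof.
move=> cX s; apply: (@cvg_comp _ _ _ X (fun M : 'M[R]_(m, q) => M i j) _ (nbhs (X s))).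
  exact: cX.
exact: coord_continuous.
Qed.

Lemma sum_continuous (T : topologicalType) m (f : 'I_m -> T -> R) :
  (forall k, continuous (f k)) -> continuous (fun s => \sum_(k < m) f k s).
Proof.
by move=> cf s; apply: cvg_big => [|k _]; [exact: add_continuous|exact: cf].
Qed.

Lemma mulmx_continuous (T : topologicalType) m q r (X : T -> 'M[R]_(m, q))
    (Y : T -> 'M[R]_(q, r)) :
  continuous X -> continuous Y -> continuous (fun s => X s *m Y s).
Proof.
move=> cX cY; apply: mx_continuous => i j.
have -> : (fun s => (X s *m Y s) i j) = fun s => \sum_k X s i k * Y s k j.
  by apply/funext => s; rewrite mxE.
apply: sum_continuous => k s; apply: cvgM; exact: entry_continuous.
Qed.

Lemma pair_continuous (T U W : topologicalType) (f : T -> U) (g : T -> W) :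
  continuous f -> continuous g -> continuous (fun s => (f s, g s)).
Proof. by move=> cf cg s; exact: cvg_pair (cf s) (cg s). Qed.

Lemma mulmx_norm_le m q r (X : 'M[R]_(m, q)) (Y : 'M[R]_(q, r)) (a b : R) :
  `|X| <= a -> `|Y| <= b -> `|X *m Y| <= q%:R * (a * b).
Proof.
move=> Xa Yb; have a0 := le_trans (normr_ge0 _) Xa; have b0 := le_trans (normr_ge0 _) Yb.
apply: mx_norm_leP => [|i j]; first by rewrite !mulr_ge0.
rewrite mxE; apply: (le_trans (ler_norm_sum _ _ _)).
apply: (@le_trans _ _ (\sum_(k < q) a * b)); last by rewrite sumr_const card_ord mulr_natl.
apply: ler_sum => k _; rewrite normrM ler_pM //.
  exact: le_trans (ler_mx_entry _ _ _) Xa.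
exact: le_trans (ler_mx_entry _ _ _) Yb.
Qed.

End MatrixContinuity.

Section MatrixField.
Context {R : realType} {n m q : nat}.
Local Notation E := 'cV[R]_n.
Variables (D : set E) (X : E * R -> 'M[R]_(m, q)).
Hypothesis hD : open D.
Hypothesis hX : forall i k, C1_lip D (fun p => X p i k).
Local Notation S := (spacetime D).

Definition space_diff (p : E * R) (h : E) : 'M[R]_(m, q) :=
  \matrix_(i, k) \sum_(j < n) partial (Some j) (fun p => X p i k) p * h j 0.

Lemma space_diff_linear p : linear (space_diff p).
Proof.
move=> a h h'; apply/matrixP => i k; rewrite !mxE mulr_sumr -big_split /=.
by apply: eq_bigr => j _; rewrite !mxE; ring.
Qed.

Lemma field_bounds : exists2 C : R, 0 <= C & forall p, S p -> `|X p| <= C /\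
  forall p', S p' -> `|X p - X p'| <= C * `|p - p'|.
Proof.
have /choice [L hL] : forall ik : 'I_m * 'I_q, exists L : R, 0 <= L /\ forall p, S p ->
    `|X p ik.1 ik.2| <= L /\
    forall p', S p' -> `|X p ik.1 ik.2 - X p' ik.1 ik.2| <= L * `|p - p'|.
  move=> [i k]; have [_ _ [L hL]] := hX i k; exists `|L|; split=> // p Sp.
  have [h1 h2] := hL p Sp; split; first exact: le_trans (ler_norm _).
  move=> p' Sp'; apply: (le_trans (h2 p' Sp')).
  by rewrite ler_wpM2r // ler_norm.
have leL ik : L ik <= \sum_ik L ik.
  by rewrite (bigD1 ik) //= lerDl sumr_ge0 // => jk _; case: (hL jk).
have L0 : 0 <= \sum_ik L ik by apply: sumr_ge0 => ik _; case: (hL ik).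
exists (\sum_ik L ik) => // p Sp; split.
  apply: mx_norm_leP => // i k; apply: le_trans (leL (i, k)).
  by case: (hL (i, k)) => _ /(_ p Sp) [].
move=> p' Sp'; apply: mx_norm_leP => [|i k]; first by rewrite mulr_ge0.
rewrite !mxE; apply: (@le_trans _ _ (L (i, k) * `|p - p'|)); last by rewrite ler_wpM2r.
by case: (hL (i, k)) => _ /(_ p Sp) [_]; exact.
Qed.

Lemma field_continuous (z : R -> E) (tau : R -> R) : continuous z -> continuous tau ->
  (forall s, S (z s, tau s)) -> continuous (fun s => X (z s, tau s)).
Proof.
move=> cz ct Sz; apply: mx_continuous => i k.
exact: (@within_curve _ _ D (fun p => X p i k) z tau cz ct Sz (C1_lip_continuous (hX i k))).
Qed.

Lemma space_diff_continuous (z h : R -> E) (tau : R -> R) : continuous z ->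
  continuous tau -> continuous h -> (forall s, S (z s, tau s)) ->
  continuous (fun s => space_diff (z s, tau s) (h s)).
Proof.
move=> cz ct ch Sz; apply: mx_continuous => i k.
have -> : (fun s => space_diff (z s, tau s) (h s) i k) = fun s =>
    \sum_(j < n) partial (Some j) (fun p => X p i k) (z s, tau s) * h s j 0.
  by apply/funext => s; rewrite mxE.
apply: sum_continuous => j s; apply: cvgM; last exact: entry_continuous.
have [_ cd _] := hX i k.
exact: (@within_curve _ _ D (partial (Some j) (fun p => X p i k)) z tau cz ct Sz (cd j)).
Qed.

Variables (c : E) (rho t0 t1 : R).
Hypotheses (t00 : 0 <= t0).
Let K : set E := [set y | `|y - c| <= rho].
Hypothesis KD : K `<=` D.

Lemma space_diff_bounded : exists2 C : R, 0 <= C & forall y s h, K y ->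
  s \in `[t0, t1] -> `|space_diff (y, s) h| <= C * `|h|.
Proof.
have /choice [L hL] : forall ikj : 'I_m * 'I_q * 'I_n, exists L : R, 0 <= L /\
    forall y s, K y -> s \in `[t0, t1] ->
    `|partial (Some ikj.2) (fun p => X p ikj.1.1 ikj.1.2) (y, s)| <= L.
  move=> [[i k] j]; have [_ cd _] := hX i k.
  by have [L L0 hL] := bounded_on_box t1 t00 KD (cd j); exists L.
have leL ik : L ik <= \sum_ik L ik.
  by rewrite (bigD1 ik) //= lerDl sumr_ge0 // => jk _; case: (hL jk).
have L0 : 0 <= \sum_ik L ik by apply: sumr_ge0 => ik _; case: (hL ik).
exists (n%:R * \sum_ik L ik); first by rewrite mulr_ge0.
move=> y s h Ky sI; apply: mx_norm_leP => [|i k]; first by rewrite !mulr_ge0.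
rewrite mxE; apply: (le_trans (ler_norm_sum _ _ _)).
apply: (@le_trans _ _ (\sum_(j < n) (\sum_ik L ik) * `|h|)); last first.
  by rewrite sumr_const card_ord -mulrA mulr_natl.
apply: ler_sum => j _; rewrite normrM ler_pM //; last exact: ler_mx_entry.
apply: le_trans (leL (i, k, j)); case: (hL (i, k, j)) => _; exact.
Qed.

Definition expands_within (e eta : R) : Prop :=
  forall y y' s, K y -> K y' -> s \in `[t0, t1] -> `|y' - y| <= eta ->
    `|X (y', s) - X (y, s) - space_diff (y, s) (y' - y)| <= e * `|y' - y| /\
    forall h, `|space_diff (y', s) h - space_diff (y, s) h| <= e * `|h|.

Lemma field_expansion e : 0 < e -> \forall eta \near (0 : R)^'+, expands_within e eta.
Proof.
move=> e0; pose e1 := e / (n%:R + 1).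
have n1 : 0 < n%:R + 1 :> R by rewrite ltr_wpDl.
have e10 : 0 < e1 by rewrite divr_gt0.
have ne1 : n%:R * e1 <= e.
  by rewrite /e1 mulrCA ler_piMr ?ltW // ltr_pdivrMr // mul1r ltrDl.
have : \forall eta \near (0 : R)^'+, forall ik : 'I_m * 'I_q, forall y y' s, K y -> K y' ->
    s \in `[t0, t1] -> `|y' - y| <= eta ->
    (forall j, `|partial (Some j) (fun p => X p ik.1 ik.2) (y', s) -
                 partial (Some j) (fun p => X p ik.1 ik.2) (y, s)| <= e1) /\
    `|X (y', s) ik.1 ik.2 - X (y, s) ik.1 ik.2 -
      \sum_(j < n) partial (Some j) (fun p => X p ik.1 ik.2) (y, s) * (y' - y) j 0| <=
      n%:R * e1 * `|y' - y|.
  by apply: filter_forall => ik; exact: (first_order_expansion t1 t00 KD (hX _ _) e10).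
apply: filterS => eta H y y' s Ky Ky' sI yy'; split.
  apply: mx_norm_leP => [|i k]; first by rewrite mulr_ge0 // ltW.
  rewrite !mxE; have [_ h] := H (i, k) y y' s Ky Ky' sI yy'.
  by apply: (le_trans h); rewrite ler_wpM2r.
move=> h; apply: mx_norm_leP => [|i k]; first by rewrite mulr_ge0 // ltW.
rewrite !mxE -sumrB; apply: (le_trans (ler_norm_sum _ _ _)).
apply: (@le_trans _ _ (\sum_(j < n) e1 * `|h|)); last first.
  by rewrite sumr_const card_ord -mulr_natl mulrA ler_wpM2r.
apply: ler_sum => j _; rewrite -mulrBl normrM ler_pM //; last exact: ler_mx_entry.
by have [+ _] := H (i, k) y y' s Ky Ky' sI yy'; exact.
Qed.

End MatrixField.

(** * The Maxey-Riley system as a Volterra equation *)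

Section MildDependence.
Context {R : realType} {n : nat}.
Local Notation E := 'cV[R]_n.
Local Notation V := (E * E)%type.
Variables (D : set E) (A B : E * R -> E) (M : E * R -> 'M[R]_n) (mu kappa t0 : R).
Hypothesis hD : open D.
Hypothesis t00 : 0 <= t0.
Hypothesis hA : forall i k, C1_lip D (fun p => A p i k).
Hypothesis hB : forall i k, C1_lip D (fun p => B p i k).
Hypothesis hM : forall i k, C1_lip D (fun p => M p i k).
Variable a : R.
Hypothesis aE : a = kappa * Num.sqrt mu.

Definition memory_part (z : V) : V := (0, - (a *: z.2)).

Definition regular_part (s : R) (z : V) : V :=
  (z.2 + A (z.1, s), - (mu *: z.2) - M (z.1, s) *m z.2 + B (z.1, s)).

Definition regular_diff (s : R) (z v : V) : V :=
  (v.2 + space_diff A (z.1, s) v.1,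
   - (mu *: v.2) - (M (z.1, s) *m v.2 + space_diff M (z.1, s) v.1 *m z.2) +
   space_diff B (z.1, s) v.1).

Lemma mild_solution_volterra d z0 z :
  mild_solution D A M B mu kappa t0 d z0 z <->
  [/\ {within `[t0, t0 + d], continuous z},
      forall t, t \in `[t0, t0 + d] -> D (z t).1 &
      volterra_solution t0 d (fun=> memory_part) regular_part z0 z].
Proof.
have yE t : (fun s => (abel_integrand (fun=> memory_part) regular_part z t s).1) =
    y_integrand A z.
  by apply/funext => s; rewrite /= scaler0 add0r.
have wE t : (fun s => (abel_integrand (fun=> memory_part) regular_part z t s).2) =
    w_integrand M B mu kappa z t.
  apply/funext => s; rewrite /w_integrand /= addrA; congr (_ + _).
  by rewrite [LHS]addrC; congr (_ + _); rewrite scalerN !scalerA -aE mulrC.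
rewrite /volterra_solution /pair_integrable /pair_integral; split.
  move=> [cz Dz hy hw]; split=> // t tI; have [i1 e1] := hy t tI.
  have [i2 e2] := hw t tI; rewrite yE wE; split=> //.
  by rewrite [z t]surjective_pairing e1 e2.
by move=> [cz Dz sol]; split=> // t tI; have := sol t tI; rewrite yE wE => -[[i1 i2] ->].
Qed.

Lemma memory_part_linear : linear memory_part.
Proof.
move=> k x y; congr (_, _); first by rewrite /= scaler0 addr0.
by rewrite /= scalerDr opprD scalerN !scalerA mulrC.
Qed.

Lemma regular_diff_linear s z : linear (regular_diff s z).
Proof.
move=> k x y; rewrite /regular_diff; congr (_, _) => /=.
  by rewrite space_diff_linear scalerDr addrACA.
rewrite !space_diff_linear !mulmxDr mulmxDl -!scalemxAr -scalemxAl.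
rewrite !scalerDr !scalerN !scalerA (mulrC mu) -!scalerA !scalerDr.
by rewrite !opprD; apply/colP => i; rewrite !mxE; ring.
Qed.

Variables (c : V) (rho : R).
Hypothesis rho0 : 0 < rho.
Hypothesis KD : [set y | `|y - c.1| <= rho] `<=` D.
Let K : set V := [set z | `|z - c| <= rho].
Local Notation I1 := `[t0, t0 + 1].
Let W : R := `|c.2| + rho.

Let W0 : 0 <= W. Proof. by rewrite addr_ge0 // ltW. Qed.

Let K1 z : K z -> `|z.1 - c.1| <= rho.
Proof. exact/le_trans/(ler_norm1 (z - c)). Qed.

Let KD1 z : K z -> D z.1.
Proof. by move=> /K1; exact: KD. Qed.

Let K2 z : K z -> `|z.2| <= W.
Proof.
move=> Kz; rewrite -(subrK c.2 z.2) /W addrC.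
apply: (le_trans (ler_normD _ _)); rewrite lerD2l.
exact: le_trans (ler_norm2 (z - c)) Kz.
Qed.

Let KS z s : s \in I1 -> K z -> spacetime D (z.1, s).
Proof.
by rewrite in_itv /= => /andP[ts _] Kz; split; [exact: KD1|exact: le_trans ts].
Qed.

Let KDS (z : V) s : s \in I1 -> D z.1 -> spacetime D (z.1, s).
Proof. by rewrite in_itv /= => /andP[ts _] Dz; split=> //; exact: le_trans ts. Qed.

Lemma regular_part_continuous (z : R -> V) : continuous z -> (forall s, K (z s)) ->
  continuous (fun s => regular_part (clamp_time t0 1 s) (z s)).
Proof.
move=> cz Kz; have ct := @clamp_time_continuous R t0 1.
have c1 : continuous (fun s => (z s).1).
  by move=> s; apply: cvg_comp (cz s) _; exact: cvg_fst.
have c2 : continuous (fun s => (z s).2).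
  by move=> s; apply: cvg_comp (cz s) _; exact: cvg_snd.
have Sz s : spacetime D ((z s).1, clamp_time t0 1 s).
  by apply: KS => //; exact: clamp_time_in.
apply: pair_continuous => s.
  by apply: cvgD; [exact: c2|exact: (field_continuous hA c1 ct Sz)].
apply: cvgD; last exact: (field_continuous hB c1 ct Sz).
apply: cvgB; first by apply: cvgN; apply: cvgZr; exact: c2.
exact: (mulmx_continuous (field_continuous hM c1 ct Sz) c2).
Qed.

Lemma regular_diff_continuous (z v : R -> V) : continuous z -> (forall s, K (z s)) ->
  continuous v -> continuous (fun s => regular_diff (clamp_time t0 1 s) (z s) (v s)).
Proof.
move=> cz Kz cv; have ct := @clamp_time_continuous R t0 1.
have fstc (x : R -> V) : continuous x -> continuous (fun s => (x s).1).
  by move=> cx s; apply: cvg_comp (cx s) _; exact: cvg_fst.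
have sndc (x : R -> V) : continuous x -> continuous (fun s => (x s).2).
  by move=> cx s; apply: cvg_comp (cx s) _; exact: cvg_snd.
have Sz s : spacetime D ((z s).1, clamp_time t0 1 s).
  by apply: KS => //; exact: clamp_time_in.
have cz1 := fstc z cz; have cz2 := sndc z cz; have cv1 := fstc v cv; have cv2 := sndc v cv.
apply: pair_continuous => s.
  by apply: cvgD; [exact: cv2|exact: (space_diff_continuous hA cz1 ct cv1 Sz)].
apply: cvgD; last exact: (space_diff_continuous hB cz1 ct cv1 Sz).
apply: cvgB; first by apply: cvgN; apply: cvgZr; exact: cv2.
apply: cvgD; first exact: (mulmx_continuous (field_continuous hM cz1 ct Sz) cv2).
exact: (mulmx_continuous (space_diff_continuous hM cz1 ct cv1 Sz) cz2).
Qed.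

Lemma memory_part_le z : `|memory_part z| <= `|a| * `|z|.
Proof.
rewrite pair_norm_le /= normr0 mulr_ge0 //= normrN normrZ ler_wpM2l //.
exact: ler_norm2.
Qed.

(** The product [M w] is Lipschitz only for bounded [w]. Writing
    [M' w' - M w = M' (w' - w) + (M' - M) w] shows that it suffices to bound [w],
    so [z'] may be any point over [D]. *)
Lemma regular_part_lipschitz : exists2 C, 0 <= C & forall s z z', s \in I1 -> K z ->
  D z'.1 -> `|regular_part s z' - regular_part s z| <= C * `|z' - z|.
Proof.
have [CA CA0 bA] := field_bounds hA; have [CB CB0 bB] := field_bounds hB.
have [CM CM0 bM] := field_bounds hM.
exists ((1 + CA) + (`|mu| + n%:R * CM + n%:R * (CM * W) + CB)).
  by rewrite !addr_ge0 // !mulr_ge0.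
move=> s z z' sI Kz Dz'; have Sz := KS sI Kz; have Sz' := KDS sI Dz'.
set x := `|z' - z|; have x0 : 0 <= x by exact: normr_ge0.
have x1 : `|z'.1 - z.1| <= x by exact: (ler_norm1 (z' - z)).
have x2 : `|z'.2 - z.2| <= x by exact: (ler_norm2 (z' - z)).
have px : `|(z'.1, s) - (z.1, s)| <= x by rewrite pair_norm_le /= subrr normr0 x1.
have dA : `|A (z'.1, s) - A (z.1, s)| <= CA * x.
  by apply: le_trans ((bA _ Sz').2 _ Sz) _; rewrite ler_wpM2l.
have dB : `|B (z'.1, s) - B (z.1, s)| <= CB * x.
  by apply: le_trans ((bB _ Sz').2 _ Sz) _; rewrite ler_wpM2l.
have dM : `|M (z'.1, s) - M (z.1, s)| <= CM * x.
  by apply: le_trans ((bM _ Sz').2 _ Sz) _; rewrite ler_wpM2l.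
have e1 : `|z'.2 + A (z'.1, s) - (z.2 + A (z.1, s))| <= (1 + CA) * x.
  rewrite opprD addrACA mulrDl mul1r.
  exact: le_trans (ler_normD _ _) (lerD x2 dA).
have h1 : `|mu *: (z'.2 - z.2)| <= `|mu| * x by rewrite normrZ ler_wpM2l.
have h2 : `|M (z'.1, s) *m (z'.2 - z.2)| <= n%:R * (CM * x).
  by apply: mulmx_norm_le => //; exact: (bM _ Sz').1.
have h3 : `|(M (z'.1, s) - M (z.1, s)) *m z.2| <= n%:R * (CM * x * W).
  by apply: mulmx_norm_le => //; exact: K2.
have e2 : `|(- (mu *: z'.2) - M (z'.1, s) *m z'.2 + B (z'.1, s)) -
    (- (mu *: z.2) - M (z.1, s) *m z.2 + B (z.1, s))| <=
    (`|mu| + n%:R * CM + n%:R * (CM * W) + CB) * x.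
  have -> : (- (mu *: z'.2) - M (z'.1, s) *m z'.2 + B (z'.1, s)) -
      (- (mu *: z.2) - M (z.1, s) *m z.2 + B (z.1, s)) =
      - (mu *: (z'.2 - z.2)) - M (z'.1, s) *m (z'.2 - z.2)
      - (M (z'.1, s) - M (z.1, s)) *m z.2 + (B (z'.1, s) - B (z.1, s)).
    rewrite scalerBr mulmxBr mulmxBl.
    move: (mu *: z'.2) (mu *: z.2) (M (z'.1, s) *m z'.2) (M (z'.1, s) *m z.2)
      (M (z.1, s) *m z.2) (B (z'.1, s)) (B (z.1, s)) => ? ? ? ? ? ? ?.
    by apply/colP => i; rewrite !mxE; ring.
  apply: (le_trans (ler_normD _ _)); apply: (le_trans (lerD (ler_normB _ _) dB)).
  apply: (le_trans (lerD (lerD (ler_normB _ _) h3) (lexx _))); rewrite normrN.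
  apply: (le_trans (lerD (lerD (lerD h1 h2) (lexx _)) (lexx _))).
  by rewrite le_eqVlt; apply/orP; left; apply/eqP; ring.
rewrite pair_norm_le /= mulrDl; apply/andP; split.
  by apply: (le_trans e1); rewrite lerDl mulr_ge0 // !addr_ge0 // !mulr_ge0.
by apply: (le_trans e2); rewrite lerDr mulr_ge0 // !addr_ge0.
Qed.

Lemma regular_diff_le : exists2 C, 0 <= C & forall s z v, s \in I1 -> K z ->
  `|regular_diff s z v| <= C * `|v|.
Proof.
have [CA CA0 bA] := space_diff_bounded hA (t0 + 1) t00 KD.
have [CB CB0 bB] := space_diff_bounded hB (t0 + 1) t00 KD.
have [CdM CdM0 bdM] := space_diff_bounded hM (t0 + 1) t00 KD.
have [CM CM0 bM] := field_bounds hM.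
exists ((1 + CA) + (`|mu| + n%:R * CM + n%:R * (CdM * W) + CB)).
  by rewrite !addr_ge0 // !mulr_ge0.
move=> s z v sI Kz; have Sz := KS sI Kz.
have v1 := ler_norm1 v; have v2 := ler_norm2 v; have v0 := normr_ge0 v.
move: (`|v|) v1 v2 v0 => x v1 v2 x0.
have dA : `|space_diff A (z.1, s) v.1| <= CA * x.
  by apply: le_trans (bA _ _ _ (K1 Kz) sI) _; rewrite ler_wpM2l.
have dB : `|space_diff B (z.1, s) v.1| <= CB * x.
  by apply: le_trans (bB _ _ _ (K1 Kz) sI) _; rewrite ler_wpM2l.
have dM : `|space_diff M (z.1, s) v.1| <= CdM * x.
  by apply: le_trans (bdM _ _ _ (K1 Kz) sI) _; rewrite ler_wpM2l.
have h1 : `|mu *: v.2| <= `|mu| * x by rewrite normrZ ler_wpM2l.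
have h2 : `|M (z.1, s) *m v.2| <= n%:R * (CM * x).
  by apply: mulmx_norm_le => //; exact: (bM _ Sz).1.
have h3 : `|space_diff M (z.1, s) v.1 *m z.2| <= n%:R * (CdM * x * W).
  by apply: mulmx_norm_le => //; exact: K2.
rewrite pair_norm_le /= mulrDl; apply/andP; split.
  apply: (@le_trans _ _ ((1 + CA) * x)).
    by rewrite mulrDl mul1r; exact: le_trans (ler_normD _ _) (lerD v2 dA).
  by rewrite lerDl mulr_ge0 // !addr_ge0 // !mulr_ge0.
apply: (@le_trans _ _ ((`|mu| + n%:R * CM + n%:R * (CdM * W) + CB) * x)); last first.
  by rewrite lerDr mulr_ge0 // !addr_ge0.
apply: (le_trans (ler_normD _ _)); apply: (le_trans (lerD (ler_normB _ _) dB)).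
rewrite normrN; apply: (le_trans (lerD (lerD h1 (ler_normD _ _)) (lexx _))).
apply: (le_trans (lerD (lerD (lexx _) (lerD h2 h3)) (lexx _))).
by rewrite le_eqVlt; apply/orP; left; apply/eqP; ring.
Qed.

Lemma part_bounds : exists2 N, 0 <= N &
  (forall z, K z -> `|memory_part z| <= N) /\
  (forall s z, s \in I1 -> K z -> `|regular_part s z| <= N).
Proof.
have [CA CA0 bA] := field_bounds hA; have [CB CB0 bB] := field_bounds hB.
have [CM CM0 bM] := field_bounds hM.
exists (`|a| * W + ((W + CA) + (`|mu| * W + n%:R * (CM * W) + CB))).
  by rewrite !addr_ge0 ?mulr_ge0 ?(ltW rho0) //.
split=> [z Kz|s z sI Kz].
  rewrite pair_norm_le /= normr0 normrN normrZ; apply/andP; split.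
    by rewrite !addr_ge0 ?mulr_ge0 ?(ltW rho0) //.
  apply: (@le_trans _ _ (`|a| * W)); first by rewrite ler_wpM2l // K2.
  by rewrite lerDl !addr_ge0 ?mulr_ge0 ?(ltW rho0) //.
have Sz := KS sI Kz; have z2 := K2 Kz.
rewrite pair_norm_le /=; apply/andP; split.
  apply: (@le_trans _ _ (W + CA)).
    exact: le_trans (ler_normD _ _) (lerD z2 (bA _ Sz).1).
  by rewrite addrCA lerDl !addr_ge0 ?mulr_ge0 ?(ltW rho0) //.
apply: (@le_trans _ _ (`|mu| * W + n%:R * (CM * W) + CB)); last first.
  by rewrite addrA lerDr !addr_ge0 ?mulr_ge0 ?(ltW rho0) //.
apply: (le_trans (ler_normD _ _)); rewrite lerD ?(bB _ Sz).1 //.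
apply: (le_trans (ler_normB _ _)); rewrite normrN normrZ lerD ?ler_wpM2l //.
by apply: mulmx_norm_le => //; exact: (bM _ Sz).1.
Qed.

(** For the product, [M' w' - M w - M (w' - w) - (dM) w] is the expansion error of
    [M] times [w] plus the quadratic term [(M' - M) (w' - w)], which is why [eta]
    is also required to be at most [e1]. *)
Lemma regular_part_expansion e : 0 < e -> \forall eta \near (0 : R)^'+,
  forall s z z', s \in I1 -> K z -> K z' -> `|z' - z| <= eta ->
  `|regular_part s z' - regular_part s z - regular_diff s z (z' - z)| <= e * `|z' - z| /\
  forall v, `|regular_diff s z' v - regular_diff s z v| <= e * `|v|.
Proof.
move=> e0; have [CM CM0 bM] := field_bounds hM.
have [CdM CdM0 bdM] := space_diff_bounded hM (t0 + 1) t00 KD.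
pose k := 1 + n%:R * CM + n%:R * CdM + n%:R * W.
have nM0 : 0 <= n%:R * CM by rewrite mulr_ge0.
have ndM0 : 0 <= n%:R * CdM by rewrite mulr_ge0.
have nW0 : 0 <= n%:R * W by rewrite mulr_ge0 // W0.
have k0 : 0 < k by rewrite /k -!addrA ltr_wpDr // !addr_ge0.
pose e1 := e / k; have e10 : 0 < e1 by rewrite divr_gt0.
have ek : e = e1 * k by rewrite divfK // gt_eqF.
have e1k r : r <= k -> e1 * r <= e by move=> rk; rewrite ek ler_wpM2l // ltW.
pose ok eta := (expands_within A c.1 rho t0 (t0 + 1) e1 eta /\
    expands_within B c.1 rho t0 (t0 + 1) e1 eta) /\
  (expands_within M c.1 rho t0 (t0 + 1) e1 eta /\ eta <= e1).
have near_ok : \forall eta \near (0 : R)^'+, ok eta.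
  apply: filterI; apply: filterI.
  - exact: (field_expansion hA (t0 + 1) t00 KD e10).
  - exact: (field_expansion hB (t0 + 1) t00 KD e10).
  - exact: (field_expansion hM (t0 + 1) t00 KD e10).
  - exact: nbhs_right_le.
apply: filterS near_ok => eta [[nA nB] [nM eta1]] s z z' sI Kz Kz' zz'.
have Sz := KS sI Kz; have Sz' := KS sI Kz'.
have y1 : `|z'.1 - z.1| <= `|z' - z| by exact: (ler_norm1 (z' - z)).
have y2 : `|z'.2 - z.2| <= `|z' - z| by exact: (ler_norm2 (z' - z)).
have yeta := le_trans y1 zz'.
have [xA vA] := nA _ _ _ (K1 Kz) (K1 Kz') sI yeta.
have [xB vB] := nB _ _ _ (K1 Kz) (K1 Kz') sI yeta.
have [xM vM] := nM _ _ _ (K1 Kz) (K1 Kz') sI yeta.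
have xe1 : `|z' - z| <= e1 by exact: le_trans zz' eta1.
have x0 : 0 <= `|z' - z| by exact: normr_ge0.
have dM : `|M (z'.1, s) - M (z.1, s)| <= CM * `|z' - z|.
  apply: le_trans ((bM _ Sz').2 _ Sz) _; rewrite ler_wpM2l //.
  by rewrite pair_norm_le /= subrr normr0 y1 x0.
move: (`|z' - z|) y1 y2 xe1 x0 dM => x y1 y2 xe1 x0 dM.
have e1ge0 := ltW e10.
split.
  rewrite pair_norm_le; apply/andP; split=> /=.
    have -> : z'.2 + A (z'.1, s) - (z.2 + A (z.1, s)) -
        (z'.2 - z.2 + space_diff A (z.1, s) (z'.1 - z.1)) =
        A (z'.1, s) - A (z.1, s) - space_diff A (z.1, s) (z'.1 - z.1).
      by rewrite sub_add3 subrr add0r.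
    apply: (le_trans xA); apply: (@le_trans _ _ (e1 * x)); first by rewrite ler_wpM2l.
    rewrite ler_wpM2r // -[e1]mulr1 e1k // /k -!addrA lerDl !addr_ge0 //.
  set dMz := space_diff M (z.1, s) (z'.1 - z.1).
  have -> : - (mu *: z'.2) - M (z'.1, s) *m z'.2 + B (z'.1, s) -
      (- (mu *: z.2) - M (z.1, s) *m z.2 + B (z.1, s)) -
      (- (mu *: (z'.2 - z.2)) - (M (z.1, s) *m (z'.2 - z.2) + dMz *m z.2) +
       space_diff B (z.1, s) (z'.1 - z.1)) =
      - ((M (z'.1, s) - M (z.1, s) - dMz) *m z.2
         + (M (z'.1, s) - M (z.1, s)) *m (z'.2 - z.2)) +
      (B (z'.1, s) - B (z.1, s) - space_diff B (z.1, s) (z'.1 - z.1)).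
    rewrite scalerBr !mulmxBr !mulmxBl.
    move: (mu *: z'.2) (mu *: z.2) (M (z'.1, s) *m z'.2) (M (z'.1, s) *m z.2)
      (M (z.1, s) *m z'.2) (M (z.1, s) *m z.2) (dMz *m z.2)
      (space_diff B (z.1, s) (z'.1 - z.1)) (B (z'.1, s)) (B (z.1, s)) => ? ? ? ? ? ? ? ? ? ?.
    by apply/colP => i; rewrite !mxE; ring.
  have h1 := mulmx_norm_le xM (K2 Kz); have h2 := mulmx_norm_le dM y2.
  apply: (le_trans (ler_normD _ _)); rewrite normrN.
  apply: (le_trans (lerD (le_trans (ler_normD _ _) (lerD h1 h2)) xB)).
  apply: (@le_trans _ _ (n%:R * (e1 * x * W) + n%:R * (CM * e1 * x) + e1 * x)).
    apply: lerD; last exact: ler_wpM2l.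
    apply: lerD; apply: ler_wpM2l => //; apply: ler_wpM2r => //; exact: ler_wpM2l.
  have -> : n%:R * (e1 * x * W) + n%:R * (CM * e1 * x) + e1 * x =
    e1 * (1 + n%:R * CM + n%:R * W) * x by ring.
  by rewrite ler_wpM2r // e1k // lerD2r lerDl.
move=> v; have v1 := ler_norm1 v; have v2 := ler_norm2 v; have v0 := normr_ge0 v.
have dMv : `|space_diff M (z'.1, s) v.1| <= CdM * `|v|.
  by apply: le_trans (bdM _ _ _ (K1 Kz') sI) _; rewrite ler_wpM2l.
move: (`|v|) v1 v2 v0 dMv => w v1 v2 w0 dMv.
have e1w h : `|h| <= w -> e1 * `|h| <= e1 * w by move=> hw; rewrite ler_wpM2l.
rewrite pair_norm_le; apply/andP; split=> /=.
  have -> : v.2 + space_diff A (z'.1, s) v.1 - (v.2 + space_diff A (z.1, s) v.1) =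
      space_diff A (z'.1, s) v.1 - space_diff A (z.1, s) v.1.
    by rewrite opprD addrACA subrr add0r.
  apply: (le_trans (vA _)); apply: (@le_trans _ _ (e1 * w)); first exact: ler_wpM2l.
  by rewrite ler_wpM2r // -[e1]mulr1 e1k // /k -!addrA lerDl !addr_ge0.
have -> : - (mu *: v.2) - (M (z'.1, s) *m v.2 + space_diff M (z'.1, s) v.1 *m z'.2) +
      space_diff B (z'.1, s) v.1 -
    (- (mu *: v.2) - (M (z.1, s) *m v.2 + space_diff M (z.1, s) v.1 *m z.2) +
      space_diff B (z.1, s) v.1) =
    - ((M (z'.1, s) - M (z.1, s)) *m v.2 +
       (space_diff M (z'.1, s) v.1 *m (z'.2 - z.2) +
        (space_diff M (z'.1, s) v.1 - space_diff M (z.1, s) v.1) *m z.2)) +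
    (space_diff B (z'.1, s) v.1 - space_diff B (z.1, s) v.1).
  rewrite mulmxBr !mulmxBl.
  move: (mu *: v.2) (M (z'.1, s) *m v.2) (M (z.1, s) *m v.2)
    (space_diff M (z'.1, s) v.1 *m z'.2) (space_diff M (z'.1, s) v.1 *m z.2)
    (space_diff M (z.1, s) v.1 *m z.2) (space_diff B (z'.1, s) v.1)
    (space_diff B (z.1, s) v.1) => ? ? ? ? ? ? ? ?.
  by apply/colP => i; rewrite !mxE; ring.
have h1 := mulmx_norm_le dM v2; have h2 := mulmx_norm_le dMv y2.
have h3 := mulmx_norm_le (vM v.1) (K2 Kz).
apply: (le_trans (ler_normD _ _)); rewrite normrN.
apply: (le_trans (lerD (le_trans (ler_normD _ _)
  (lerD h1 (le_trans (ler_normD _ _) (lerD h2 h3)))) (vB _))).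
apply: (@le_trans _ _ (n%:R * (CM * e1 * w) + (n%:R * (CdM * w * e1) +
    n%:R * (e1 * w * W)) + e1 * w)).
  apply: lerD; last exact: ler_wpM2l.
  apply: lerD; last apply: lerD; apply: ler_wpM2l => //.
  - by apply: ler_pM => //; [rewrite mulr_ge0|exact: ler_wpM2l].
  - by apply: ler_wpM2l => //; rewrite mulr_ge0.
  - by apply: ler_wpM2r; [exact: W0|exact: ler_wpM2l].
have -> : n%:R * (CM * e1 * w) + (n%:R * (CdM * w * e1) +
    n%:R * (e1 * w * W)) + e1 * w = e1 * k * w by rewrite /k; ring.
by rewrite -ek.
Qed.

End MildDependence.

Unset Implicit Arguments.

Theorem theorem3 (R : realType) (n : nat) (hn : n = 2%N \/ n = 3%N)
  (D : set 'cV[R]_n) (hD : open D) (u : 'cV[R]_n * R -> 'cV[R]_n)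
  (t0 : R) (ht0 : 0 <= t0) (g : 'cV[R]_n)
  (rho_f rho_p St Re : R)
  (hrho_f : 0 < rho_f) (hrho_p : 0 < rho_p) (hSt : 0 < St) (hRe : 0 < Re)
  (Rr mu kappa gamma : R)
  (hRr : Rr = 2 * rho_f / (rho_f + 2 * rho_p))
  (hmu : mu = Rr / St)
  (hkappa : kappa = Num.sqrt (9 * Rr / (2 * pi)))
  (hgamma : gamma = 9 * Rr / (2 * Re))
  (hu : H2 D u) :
  forall (y0 w0 : 'cV[R]_n), D y0 ->
    exists delta : R, 0 < delta /\
      (exists z : R -> 'cV[R]_n * 'cV[R]_n,
         unique_mild_solution D (A_field gamma mu u) (M_field gamma mu u)
           (B_field Rr gamma mu g u) mu kappa t0 delta (y0, w0) z) /\
      C1_initial_condition D (A_field gamma mu u) (M_field gamma mu u)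
        (B_field Rr gamma mu g u) mu kappa t0 delta (y0, w0).
Proof.
move=> y0 w0 Dy0; set A := A_field _ _ _; set M := M_field _ _ _; set B := B_field _ _ _ _ _.
have hA i k : C1_lip D (fun p => A p i k).
  by rewrite (ord1 k); exact: A_field_C1_lip hD hu gamma mu i.
have hB i k : C1_lip D (fun p => B p i k).
  by rewrite (ord1 k); exact: B_field_C1_lip hD hu Rr gamma mu g i.
have hM i k : C1_lip D (fun p => M p i k) by exact: M_field_C1_lip.
pose c : 'cV[R]_n * 'cV[R]_n := (y0, w0).
have [r r0 rD] : exists2 r : R, 0 < r & [set y | `|y - y0| <= r] `<=` D.
  have /nbhs_ballP [r /= r0 hr] := open_nbhs_nbhs (conj hD Dy0).
  exists (r / 2); first by rewrite divr_gt0.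
  move=> y hy; apply: hr; rewrite -ball_normE /= distrC.
  by apply: (le_lt_trans hy); rewrite ltr_pdivrMr // mulr_natr mulr2n ltrDl.
pose a := kappa * Num.sqrt mu.
have [C1 C10 G_lip] := regular_part_lipschitz mu ht0 hA hB hM r0 rD (c := c).
have [C2 C20 dG_le] := regular_diff_le mu ht0 hA hB hM r0 rD (c := c).
have [N N0 [L_bound G_bound]] := part_bounds mu ht0 hA hB hM a r0 rD (c := c).
pose C : R := `|a| + C1 + C2.
have C0 : 0 <= C by rewrite !addr_ge0.
have aC : `|a| <= C by rewrite /C -addrA lerDl addr_ge0.
have C1C : C1 <= C by rewrite /C addrAC lerDr addr_ge0.
have C2C : C2 <= C by rewrite /C lerDr addr_ge0.
pose K : set ('cV[R]_n * 'cV[R]_n) := [set z | `|z - c| <= r].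
have KD z : K z -> D z.1.
  by move=> Kz; apply: rD; exact: le_trans (ler_norm1 (z - c)) Kz.
have L_le (z : 'cV[R]_n * 'cV[R]_n) : `|memory_part a z| <= C * `|z|.
  by apply: (le_trans (memory_part_le a z)); rewrite ler_wpM2r.
have G_lip' s z z' : s \in `[t0, t0 + 1] -> K z -> D z'.1 ->
    `|regular_part A B M mu s z' - regular_part A B M mu s z| <= C * `|z' - z|.
  by move=> sI Kz Dz'; apply: (le_trans (G_lip s z z' sI Kz Dz')); rewrite ler_wpM2r.
have dG_le' s z v : s \in `[t0, t0 + 1] -> K z ->
    `|regular_diff A B M mu s z v| <= C * `|v|.
  by move=> sI Kz; apply: (le_trans (dG_le s z v sI Kz)); rewrite ler_wpM2r.
have [d [d0 d1 [U [Phi [oU UD sol uniq smooth]]]]] :=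
  C1_dependence r0 C0 N0 KD (memory_part_linear a) L_le
    (@regular_part_continuous _ _ D A B M mu t0 ht0 hA hB hM c r rD)
    (@regular_diff_continuous _ _ D A B M mu t0 ht0 hA hB hM c r rD)
    G_lip' (regular_diff_linear A B M mu) dG_le'
    (@regular_part_expansion _ _ D A B M mu t0 ht0 hA hB hM c r r0 rD) L_bound G_bound.
have mild z0 z := @mild_solution_volterra _ _ D A B M mu kappa t0 a (erefl a) d z0 z.
have unique z0 : U z0 -> unique_mild_solution D A M B mu kappa t0 d z0 (Phi z0).
  move=> Uz; have [cPhi DPhi sPhi] := sol z0 Uz; split.
    by apply/mild; split=> //; exact: continuous_subspaceT.
  by move=> z /mild [cz Dz sz]; exact: uniq.
exists d; split=> //; split.
  by exists (Phi c); apply: unique; case: oU.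
exists U, Phi; split=> // z Uz; split=> //; exact: UD.
Qed.
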